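(* Let $2<n<\omega$. There is an atomic, simple, countable algebra $\mathfrak{A}\in \mathsf{RCA}_n$ (i.e. $\mathfrak{A}$ has the neat embedding property) which does not have the complex $\mathbf{S}$ neat embedding property up to $m$ for any $m$ with $n+3\leq m\leq\omega$; that is, $\mathfrak{Cm}\,\mathsf{At}\,\mathfrak{A}\notin \mathbf{S}\,\mathsf{Nr}_n\mathsf{CA}_m$ for every $m$ with $n+3\leq m\leq \omega$.
   Context: For an ordinal $\alpha$, $\mathsf{CA}_\alpha$ is the class of cylindric algebras of dimension $\alpha$ (Henkin–Monk–Tarski): Boolean algebras with unary operations $\mathsf{c}_i$ and constants $\mathsf{d}_{ij}$ ($i,j<\alpha$) satisfying $\mathsf{c}_i0=0$; $x\le \mathsf{c}_ix$; $\mathsf{c}_i(x\cdot \mathsf{c}_iy)=\mathsf{c}_ix\cdot \mathsf{c}_iy$; $\mathsf{c}_i\mathsf{c}_jx=\mathsf{c}_j\mathsf{c}_ix$; $\mathsf{d}_{ii}=1$; $\mathsf{d}_{ij}=\mathsf{c}_k(\mathsf{d}_{ik}\cdot \mathsf{d}_{kj})$ for $k\ne i,j$; $\mathsf{c}_i(\mathsf{d}_{ij}\cdot x)\cdot \mathsf{c}_i(\mathsf{d}_{ij}\cdot -x)=0$ for $i\ne j$. For $\alpha\le\beta$ and $\mathfrak{B}\in\mathsf{CA}_\beta$, the $\alpha$-neat reduct $\mathfrak{Nr}_\alpha\mathfrak{B}\in\mathsf{CA}_\alpha$ is obtained from $\mathfrak{B}$ by discarding the cylindrifiers and diagonal elements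 with indices in $\beta\setminus\alpha$ and restricting the universe to $\{x\in\mathfrak{B}:\{i<\beta:\mathsf{c}_ix\ne x\}\subseteq\alpha\}$. $\mathsf{Nr}_\alpha\mathbf{K}=\{\mathfrak{Nr}_\alpha\mathfrak{B}:\mathfrak{B}\in\mathbf{K}\}$. $\mathbf{S}$ denotes forming subalgebras (up to isomorphism). $\mathsf{RCA}_n$ is the class of representable $\mathsf{CA}_n$s, i.e. algebras isomorphic to generalized cylindric set algebras of dimension $n$ (fields of subsets of a disjoint union of Cartesian squares ${}^nU_i$, with the set-theoretic cylindrifications and diagonals); $\mathsf{RCA}_n=\mathbf{S}\,\mathsf{Nr}_n\mathsf{CA}_\omega$. An algebra has the neat embedding property if it belongs to $\mathbf{S}\,\mathsf{Nr}_n\mathsf{CA}_\omega$. An algebra is atomic if its Boolean reduct is. For atomic $\mathfrak{A}\in\mathsf{CA}_n$, $\mathsf{At}\,\mathfrak{A}$ is its atom structure (the set of atoms with relations $R_i=\{(a,b):a\le \mathsf{c}_ib\}$ and subsets $D_{ij}=\{a:a\le \mathsf{d}_{ij}\}$), and $\mathfrak{Cm}\,\mathsf{At}\,\mathfrak{A}$ is the complex algebra of this structure (the algebra on all sets of atoms), which is the Dedekind–MacNeille completion of $\mathfrak{A}$. An atomic $\mathfrak{A}\in\mathsf{CA}_n$ has the complex $\mathbf{S}$ neat embedding property up to $m$ if $\mathfrak{Cm}\,\mathsf{At}\,\mathfrak{A}\in\mathbf{S}\,\mathsf{Nr}_n\mathsf{CA}_m$. *)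

(* Defs.v *)
From HB Require Import structures.
From mathcomp Require Import all_boot all_order.
From mathcomp Require Import boolp classical_sets cardinality.

Set Implicit Arguments.
Unset Strict Implicit.
Unset Printing Implicit Defensive.

Import Order.TTheory Order.CTheory.
Local Open Scope order_scope.

(* Boolean algebras are the library's [ctbDistrLatticeType]s: [`&`], [`|`],
   [~`], [\bot], [\top] are product, sum, complement, 0 and 1.  The library
   does not require [\bot != \top], so the one-element algebra is included. *)

(* Boolean algebras with operations of the cylindric similarity type, without
   the cylindric axioms, over an arbitrary index type [I] (the dimension). *)
Record cylType (I : eqType) := CylType {
  cyl_disp : Order.disp_t;
  cyl_sort :> ctbDistrLatticeType cyl_disp;
  cyl : I -> cyl_sort -> cyl_sort;
  diag : I -> I -> cyl_sort
}.

Record CA_axioms (I : eqType) (A : cylType I) : Prop := CAAxioms {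
  cyl0 : forall i, cyl i (\bot : A) = \bot;
  cyl_ge : forall i (x : A), x <= cyl i x;
  cylI : forall i (x y : A), cyl i (x `&` cyl i y) = cyl i x `&` cyl i y;
  cylC : forall i j (x : A), cyl i (cyl j x) = cyl j (cyl i x);
  diagii : forall i, diag A i i = \top;
  diag_cyl : forall i j k, k != i -> k != j ->
    diag A i j = cyl k (diag A i k `&` diag A k j);
  cyl_diag : forall i j (x : A), i != j ->
    cyl i (diag A i j `&` x) `&` cyl i (diag A i j `&` ~` x) = \bot
}.

Record CA (I : eqType) := MkCA {
  CA_sort :> cylType I;
  CA_ax : CA_axioms CA_sort
}.

Record cyl_hom (I : eqType) (A B : cylType I) (h : A -> B) : Prop := CylHom {
  homI : forall x y, h (x `&` y) = h x `&` h y;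
  homU : forall x y, h (x `|` y) = h x `|` h y;
  homC : forall x, h (~` x) = ~` h x;
  hom0 : h \bot = \bot;
  hom1 : h \top = \top;
  hom_cyl : forall i x, h (cyl i x) = cyl i (h x);
  hom_diag : forall i j, h (diag A i j) = diag B i j
}.

(* [A] is isomorphic to a subalgebra of [B], i.e. A is in S{B}. *)
Definition embeds (I : eqType) (A B : cylType I) : Prop :=
  exists h : A -> B, injective h /\ cyl_hom h.

(* The inclusion of the smaller dimension in the larger one is given by an
   injection [f] of the index types. *)

Section NeatReduct.
Variables (I J : eqType) (f : I -> J) (B : CA J).

Definition neat (x : B) : Prop := ([set j | cyl j x <> x] `<=` range f)%classic.

Definition neat_sort : Type := {x : B | `[< neat x >]}.

HB.instance Definition _ := Choice.on neat_sort.
HB.instance Definition _ := SubChoice.on neat_sort.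

Lemma neatP (x : B) : neat x <-> forall j, ~ range f j -> cyl j x = x.
Proof.
split=> [H j Nj|H j /= Hj]; first by apply: contrapT => /H.
by apply: contrapT => /H.
Qed.

Lemma cyl1 j : cyl j (\top : B) = \top.
Proof. by apply/eqP; rewrite -le1x; exact: cyl_ge (CA_ax B) j _. Qed.

Lemma cyl_idem j (x : B) : cyl j (cyl j x) = cyl j x.
Proof. by rewrite -[cyl j x in LHS]meet1x (cylI (CA_ax B)) cyl1 meet1x. Qed.

Lemma neat0 : neat \bot.
Proof. by apply/neatP => j _; rewrite (cyl0 (CA_ax B)). Qed.

Lemma neat1 : neat \top.
Proof. by apply/neatP => j _; rewrite cyl1. Qed.

Lemma neatC (x : B) : neat x -> neat (~` x).
Proof.
move/neatP => H; apply/neatP => j /H Hj.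
apply/eqP; rewrite eq_le (cyl_ge (CA_ax B)) andbT.
rewrite -disj_leC; apply/eqP.
by rewrite -{2}Hj -(cylI (CA_ax B)) Hj meetC meetxC (cyl0 (CA_ax B)).
Qed.

Lemma neatI (x y : B) : neat x -> neat y -> neat (x `&` y).
Proof.
move=> /neatP Hx /neatP Hy; apply/neatP => j Nj.
by rewrite -{1}(Hy j Nj) (cylI (CA_ax B)) Hx // Hy.
Qed.

Lemma neatU (x y : B) : neat x -> neat y -> neat (x `|` y).
Proof.
by move=> Hx Hy; rewrite -[_ `|` _]complK complU; apply: neatC; apply: neatI;
  apply: neatC.
Qed.

Lemma neat_cyl i (x : B) : neat x -> neat (cyl i x).
Proof.
by move=> /neatP Hx; apply/neatP => j Nj; rewrite (cylC (CA_ax B)) Hx.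
Qed.

Lemma neat_diag i k : neat (diag B (f i) (f k)).
Proof.
apply/neatP => j Nj.
have Nf l : j != f l by apply/eqP => E; apply: Nj; exists l.
by rewrite (diag_cyl (CA_ax B) (Nf i) (Nf k)) cyl_idem.
Qed.

Definition mkNeat (x : B) (nx : neat x) : neat_sort := exist _ x (asboolT nx).

Lemma neat_valP (x : neat_sort) : neat (val x).
Proof. exact: asboolW (valP x). Qed.
Arguments neat_valP : clear implicits.

Let nmeet (x y : neat_sort) := mkNeat (neatI (neat_valP x) (neat_valP y)).
Let njoin (x y : neat_sort) := mkNeat (neatU (neat_valP x) (neat_valP y)).
Let ncompl (x : neat_sort) := mkNeat (neatC (neat_valP x)).
Let nle (x y : neat_sort) := val x <= val y.
Let nlt (x y : neat_sort) := val x < val y.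

Let nle_def x y : nle x y = (nmeet x y == x).
Proof. by rewrite -val_eqE /= -leEmeet. Qed.
Let nlt_def x y : nlt x y = (y != x) && nle x y.
Proof. by rewrite /nlt lt_def -val_eqE. Qed.
Let nmeetC : commutative nmeet.
Proof. by move=> x y; apply: val_inj; exact: meetC. Qed.
Let njoinC : commutative njoin.
Proof. by move=> x y; apply: val_inj; exact: joinC. Qed.
Let nmeetA : associative nmeet.
Proof. by move=> x y z; apply: val_inj; exact: meetA. Qed.
Let njoinA : associative njoin.
Proof. by move=> x y z; apply: val_inj; exact: joinA. Qed.
Let njoinKI y x : nmeet x (njoin x y) = x.
Proof. by apply: val_inj; exact: joinKI. Qed.
Let nmeetKU y x : njoin x (nmeet x y) = x.
Proof. by apply: val_inj; exact: meetKU. Qed.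
Let nmeetUl : left_distributive nmeet njoin.
Proof. by move=> x y z; apply: val_inj; exact: meetUl. Qed.
Let nmeetxx : idempotent_op nmeet.
Proof. by move=> x; apply: val_inj; exact: meetxx. Qed.

HB.instance Definition _ := Order.isMeetJoinDistrLattice.Build
  (cyl_disp B) neat_sort nle_def nlt_def nmeetC njoinC nmeetA njoinA njoinKI
  nmeetKU nmeetUl nmeetxx.

Let nle0x (x : neat_sort) : mkNeat neat0 <= x.
Proof. exact: le0x. Qed.
Let nlex1 (x : neat_sort) : x <= mkNeat neat1.
Proof. exact: lex1. Qed.

HB.instance Definition _ := Order.hasBottom.Build (cyl_disp B) neat_sort nle0x.
HB.instance Definition _ := Order.hasTop.Build (cyl_disp B) neat_sort nlex1.

Let njoinxC (x : neat_sort) : x `|` ncompl x = \top.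
Proof. by apply: val_inj; exact: joinxC. Qed.
Let nmeetxC (x : neat_sort) : x `&` ncompl x = \bot.
Proof. by apply: val_inj; exact: meetxC. Qed.

HB.instance Definition _ := Order.TBDistrLattice_hasComplement.Build
  (cyl_disp B) neat_sort njoinxC nmeetxC.

Definition neat_cylType : cylType I := {|
  cyl_sort := neat_sort : ctbDistrLatticeType _;
  cyl := fun i (x : neat_sort) => mkNeat (@neat_cyl (f i) _ (neat_valP x));
  diag := fun i j => mkNeat (@neat_diag i j)
|}.

Hypothesis f_inj : injective f.

Lemma neat_axioms : CA_axioms neat_cylType.
Proof.
have A := CA_ax B; split=> [i|i x|i x y|i j x|i|i j k ki kj|i j x ij].
- by apply: val_inj; exact: cyl0.
- exact: (@cyl_ge _ _ A (f i) (val x)).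
- by apply: val_inj; exact: cylI.
- by apply: val_inj; exact: cylC.
- by apply: val_inj; exact: diagii.
- by apply: val_inj; apply: diag_cyl => //; rewrite (inj_eq f_inj).
- by apply: val_inj; apply: (cyl_diag A); rewrite (inj_eq f_inj).
Qed.

Definition neat_reduct : CA I := MkCA neat_axioms.

End NeatReduct.

(* The ordinals up to omega; [Fin n] is n, with index set ['I_n]. *)

Variant dim := Fin of nat | Omega.

Definition dim_le (a b : dim) : bool :=
  match a, b with
  | Fin m, Fin n => (m <= n)%N
  | _, Omega => true
  | Omega, Fin _ => false
  end.

Definition dim_idx (a : dim) : eqType :=
  match a with Fin n => 'I_n | Omega => nat end.

Definition dim_incl (a b : dim) : dim_le a b -> dim_idx a -> dim_idx b :=
  match a, b return dim_le a b -> dim_idx a -> dim_idx b with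
  | Fin m, Fin n => fun mn i => widen_ord mn i
  | Fin m, Omega => fun _ i => nat_of_ord i
  | Omega, Omega => fun _ i => i
  | Omega, Fin _ => fun no => False_rect _ (notF no)
  end.

Lemma dim_incl_inj a b (ab : dim_le a b) : injective (dim_incl ab).
Proof.
case: a b ab => [m|] [n|] ab //= i j; last exact: val_inj.
by move/(congr1 val) => /= /val_inj.
Qed.

Definition Nr (a b : dim) (ab : dim_le a b) (B : CA (dim_idx b)) :
  CA (dim_idx a) := neat_reduct B (@dim_incl_inj a b ab).

(* [A] belongs to S Nr_a CA_b. *)
Definition SNr (a b : dim) (A : cylType (dim_idx a)) : Prop :=
  exists (ab : dim_le a b) (B : CA (dim_idx b)), embeds A (Nr ab B).

Definition NEP (a : dim) (A : cylType (dim_idx a)) : Prop := SNr Omega A.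

(* The algebra of all subsets of the disjoint union of the squares
   [I -> U j], [j : T]; a point of the union is a pair [existT _ j s].
   Generalized cylindric set algebras are the subalgebras of these. *)
Definition full_gcs (I : eqType) (T : Type) (U : T -> Type) : cylType I := {|
  cyl_sort := set {j : T & I -> U j} : ctbDistrLatticeType set_display;
  cyl := fun i X => [set s : {j : T & I -> U j} | exists t : I -> U (projT1 s),
    (forall k, k != i -> t k = projT2 s k) /\ X (existT _ (projT1 s) t)]%classic;
  diag := fun i j => [set s : {j : T & I -> U j} | projT2 s i = projT2 s j]%classic
|}.

Definition RCA (I : eqType) (A : cylType I) : Prop :=
  exists (T : Type) (U : T -> Type), embeds A (full_gcs I U).

Definition atom d (A : ctbDistrLatticeType d) (a : A) : Prop :=
  a <> \bot /\ forall x : A, x <= a -> x = \bot \/ x = a.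

Definition atomic d (A : ctbDistrLatticeType d) : Prop :=
  forall x : A, x <> \bot -> exists a : A, atom a /\ a <= x.

Record atom_structure (I : eqType) := AtomStructure {
  at_sort :> Type;
  at_rel : I -> at_sort -> at_sort -> Prop;
  at_diag : I -> I -> set at_sort
}.

Definition At (I : eqType) (A : cylType I) : atom_structure I := {|
  at_sort := {a : A | atom a};
  at_rel := fun i a b => sval a <= cyl i (sval b);
  at_diag := fun i j => [set a | sval a <= diag A i j]%classic
|}.

(* Only a [cylType]: the cylindric axioms fail for an arbitrary [S].  They hold
   when [S] is the atom structure of an atomic CA. *)
Definition Cm (I : eqType) (S : atom_structure I) : cylType I := {|
  cyl_sort := set S : ctbDistrLatticeType set_display;
  cyl := fun i X => [set a : S | exists2 b, X b & at_rel i a b]%classic;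
  diag := fun i j => @at_diag I S i j
|}.

Definition complex_SNEP (a m : dim) (A : cylType (dim_idx a)) : Prop :=
  SNr m (Cm (At A)).

Record congruence (I : eqType) (A : cylType I) (R : A -> A -> Prop) : Prop :=
  Congruence {
  congr_refl : forall x, R x x;
  congr_sym : forall x y, R x y -> R y x;
  congr_trans : forall x y z, R x y -> R y z -> R x z;
  congrI : forall x x' y y', R x x' -> R y y' -> R (x `&` y) (x' `&` y');
  congrU : forall x x' y y', R x x' -> R y y' -> R (x `|` y) (x' `|` y');
  congrC : forall x x', R x x' -> R (~` x) (~` x');
  congr_cyl : forall i x x', R x x' -> R (cyl i x) (cyl i x')
}.

Definition simple (I : eqType) (A : cylType I) : Prop :=
  (\bot : A) <> \top /\
  forall R : A -> A -> Prop, congruence R ->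
    (forall x y, R x y -> x = y) \/ (forall x y, R x y).

(* Main.v *)
Require Import Defs.
From HB Require Import structures.
From mathcomp Require Import all_boot all_order.
From mathcomp Require Import zify.
From mathcomp Require Import boolp classical_sets cardinality.

(* Write n = k + 3.  The algebra consists of definable n-ary relations on a
   countable structure M whose points are apexes (with one of four tints), base
   points of two kinds, and side points of k kinds.  Over a side tuple h, an apex
   may be green to a base point, a pair of base points carries a set of allowed
   tints, and two apexes of different tints are joined by a white or a red edge.
   Two apexes green to both points of a base cannot be joined by a white edge, and
   a red triangle over h must have equal superscripts t and edge parities adding up
   to a value that depends on its three tints.  For four apexes over one base the
   parities of the four triangles are contradictory, since every edge lies in two
   triangles; n + 3 points suffice to see this, which excludes the complex algebra.

   M avoids the contradiction by a further label, a limit of the reds t -> oo, whose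
   triangles carry no parity condition.  M is built step by step so that every one-point
   extension of n - 1 points is realised; a limit edge is only ever needed between
   two apexes over a common base, that is, among n + 1 points, more than the type of
   an n-tuple can prescribe.
   Relations are in the algebra when they do not separate the limit label from the
   reds of large superscript: hence its atoms are the types without limit edges,
   while unions over all superscripts of reds with a given parity exist only in the
   completion. *)

Set Implicit Arguments.
Unset Strict Implicit.
Unset Printing Implicit Defensive.

Notation color := (option (bool + nat * bool)) (only parsing).
Notation white e := (Some (inl e)).
Notation red t e := (Some (inr (t, e))).

(** Consistency may only speak of n = k + 3 points at a time, but two apexes over a common base are
    k + 4 points, so no single rule can forbid a white edge there. This is why white edges come in
    two kinds: [white e] is refuted by one common green neighbour of sort [base e], that is, on n
    points, and over a base both kinds are refuted. The k side points bring a triangle of apexes to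
    exactly n points, so an n-tuple never contains two triangles over one side tuple. Four apexes,
    two base points and k side points make n + 3.

    The sets of allowed tints absorb a side effect of the construction. A new base point may put two
    apexes, already joined by a red with a superscript, over a common base. An apex of a third tint
    over that base would need limit edges, which do not fit into a triangle with such a red;
    therefore a third tint must not be allowed there. *)

Definition is_red (c : color) : bool := if c is white _ then false else true.

(* [None] is the limit of the reds [red t e] as t grows; it forgets the parity, so
   triangles of limit edges are always allowed. *)
Definition red_ok (p : bool) (c1 c2 c3 : color) : Prop :=
  [/\ c1 = None, c2 = None & c3 = None] \/
  exists t e1 e2, [/\ c1 = red t e1, c2 = red t e2 & c3 = red t (e1 (+) e2 (+) p)].

Lemma red_okC p c1 c2 c3 : red_ok p c1 c2 c3 -> red_ok p c2 c1 c3.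
Proof.
case=> [[-> -> ->]|[t [e1 [e2 [-> -> ->]]]]]; first by left.
by right; exists t, e2, e1; rewrite (addbC e2).
Qed.

Lemma red_okR p c1 c2 c3 : red_ok p c1 c2 c3 -> red_ok p c3 c2 c1.
Proof.
case=> [[-> -> ->]|[t [e1 [e2 [-> -> ->]]]]]; first by left.
right; exists t, (e1 (+) e2 (+) p), e2; split=> //.
by case: e1 e2 p => [] [] [].
Qed.

Lemma red_ok23 p c1 c2 c3 : red_ok p c1 c2 c3 -> red_ok p c1 c3 c2.
Proof. by move=> H; apply/red_okC/red_okR/red_okC. Qed.

(** * Labelled structures *)

Section Structures.
Variable k : nat.
Local Notation J := ('I_k).
Local Notation sort_t := ('I_4 + (bool + 'I_k))%type.
Local Notation apex i := (inl i : sort_t).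
Local Notation base e := (inr (inl e) : sort_t).
Local Notation side j := (inr (inr j) : sort_t).

Definition is_apex (s : sort_t) : bool := if s is inl _ then true else false.

(** Of the four triangles on the tints 0, 1, 2, 3 exactly one omits tint 0. Adding the four parity
    conditions therefore gives 0 = 1, as every edge is counted twice. *)
Definition par (s1 s2 s3 : sort_t) : bool :=
  [&& s1 != apex ord0, s2 != apex ord0 & s3 != apex ord0].

Lemma parC s1 s2 s3 : par s1 s2 s3 = par s2 s1 s3.
Proof. by rewrite /par andbCA. Qed.
Lemma parR s1 s2 s3 : par s1 s2 s3 = par s3 s2 s1.
Proof. by rewrite /par andbC -andbA [in RHS]andbCA. Qed.

(* [gr0], [co0], [sh0] are the green relation, the colour of an edge and the set of
   allowed tints, over a side tuple.  They are only read through [grn], [col] and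
   [shd] below, which replace them by default values on arguments of the wrong
   sorts. *)
Record str (V : Type) := Str {
  so : V -> sort_t;
  gr0 : V -> V -> (J -> V) -> bool;
  co0 : V -> V -> (J -> V) -> color;
  sh0 : V -> V -> (J -> V) -> {set 'I_4} }.

Section Accessors.
Variables (V : Type) (st : str V).

Definition prp (h : J -> V) : bool := [forall j, so st (h j) == side j].

Definition grn e (a b : V) (h : J -> V) : bool :=
  [&& is_apex (so st a), so st b == base e, prp h & gr0 st a b h].

Definition col (a b : V) (h : J -> V) : color :=
  if [&& is_apex (so st a), is_apex (so st b), so st a != so st b & prp h]
  then co0 st a b h else white false.

Definition shd (b c : V) (h : J -> V) : {set 'I_4} :=
  if [&& so st b == base false, so st c == base true & prp h]
  then sh0 st b c h else finset.set0.

Definition over (a b c : V) (h : J -> V) : bool :=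
  grn false a b h && grn true a c h.

Lemma col_red a b h : is_red (col a b h) ->
  [/\ is_apex (so st a), is_apex (so st b), so st a != so st b & prp h].
Proof. by rewrite /col; case: and4P. Qed.

Lemma grnP e a b h : grn e a b h ->
  [/\ is_apex (so st a), so st b = base e & prp h].
Proof. by case/and4P => ? /eqP ? ? _. Qed.

(** The conditions are relative to [G] so that they apply alike to a face, to a finite stage and to
    the limit structure. Each involves at most k + 3 points. *)
Record cons (G : V -> Prop) : Prop := Cons {
  co_sym : forall a b h, G a -> G b -> (forall j, G (h j)) ->
    col a b h = col b a h;
  co_tri : forall a b c h, G a -> G b -> G c -> (forall j, G (h j)) ->
    is_red (col a b h) -> is_red (col b c h) -> is_red (col a c h) ->
    red_ok (par (so st a) (so st b) (so st c)) (col a b h) (col b c h) (col a c h);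
  co_grn : forall e a b d h, G a -> G b -> G d -> (forall j, G (h j)) ->
    so st a != so st b -> grn e a d h -> grn e b d h -> col a b h != white e;
  co_shd : forall i a b c h, G a -> G b -> G c -> (forall j, G (h j)) ->
    so st a = apex i -> over a b c h -> i \in shd b c h }.

End Accessors.

Definition pull V V' (f : V -> V') (st : str V') : str V :=
  Str (so st \o f) (fun a b h => gr0 st (f a) (f b) (f \o h))
    (fun a b h => co0 st (f a) (f b) (f \o h))
    (fun a b h => sh0 st (f a) (f b) (f \o h)).

(** Agreement concerns the labels as read by [grn], [col] and [shd], so raw values on arguments of
    the wrong sorts do not count. *)
Record same V V' (st : str V) (st' : str V') (f : V -> V') (G : V -> Prop) : Prop :=
  Same {
  sm_so : forall a, G a -> so st' (f a) = so st a;
  sm_grn : forall e a b h, G a -> G b -> (forall j, G (h j)) ->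
    grn st' e (f a) (f b) (f \o h) = grn st e a b h;
  sm_col : forall a b h, G a -> G b -> (forall j, G (h j)) ->
    col st' (f a) (f b) (f \o h) = col st a b h;
  sm_shd : forall a b h, G a -> G b -> (forall j, G (h j)) ->
    shd st' (f a) (f b) (f \o h) = shd st a b h }.

Lemma same_pull V V' (f : V -> V') (st : str V') G : same (pull f st) st f G.
Proof. by []. Qed.

Lemma same_refl V (st : str V) G : same st st id G.
Proof. by []. Qed.

Lemma same_ext V V' (st : str V) (st' : str V') f f' (G : V -> Prop) :
  (forall a, G a -> f a = f' a) -> same st st' f G -> same st st' f' G.
Proof.
move=> E S.
have Eh (h : J -> V) : (forall j, G (h j)) -> f' \o h = f \o h.
  by move=> Gh; apply/funext => j /=; rewrite E.
split.
- by move=> a Ga; rewrite -E // (sm_so S).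
- by move=> e a b h Ga Gb Gh; rewrite -!E // Eh // (sm_grn S).
- by move=> a b h Ga Gb Gh; rewrite -!E // Eh // (sm_col S).
- by move=> a b h Ga Gb Gh; rewrite -!E // Eh // (sm_shd S).
Qed.

Lemma same_pullr V V' V'' (st : str V) (st' : str V'') (f : V -> V') (g : V' -> V'') G :
  same st st' (g \o f) G -> same st (pull g st') f G.
Proof. by case=> H1 H2 H3 H4; split. Qed.

Lemma same_trans V1 V2 V3 (s1 : str V1) (s2 : str V2) (s3 : str V3) f g
    (G1 : V1 -> Prop) (G2 : V2 -> Prop) :
  (forall a, G1 a -> G2 (f a)) ->
  same s1 s2 f G1 -> same s2 s3 g G2 -> same s1 s3 (g \o f) G1.
Proof.
move=> sG S1 S2; split.
- by move=> a Ga; rewrite /= (sm_so S2) ?(sm_so S1) //; exact: sG.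
- move=> e a b h Ga Gb Gh; rewrite /= -(sm_grn S1) //.
  by rewrite -(sm_grn S2) //; [exact: sG|exact: sG|move=> j; exact/sG].
- move=> a b h Ga Gb Gh; rewrite /= -(sm_col S1) //.
  by rewrite -(sm_col S2) //; [exact: sG|exact: sG|move=> j; exact/sG].
- move=> a b h Ga Gb Gh; rewrite /= -(sm_shd S1) //.
  by rewrite -(sm_shd S2) //; [exact: sG|exact: sG|move=> j; exact/sG].
Qed.

Lemma same_sub V V' (st : str V) (st' : str V') f (G G' : V -> Prop) :
  (forall a, G' a -> G a) -> same st st' f G -> same st st' f G'.
Proof.
move=> sG S; split.
- by move=> a /sG; apply: sm_so.
- by move=> e a b h /sG Ga /sG Gb Gh; apply: (sm_grn S) => // j; exact: sG.
- by move=> a b h /sG Ga /sG Gb Gh; apply: (sm_col S) => // j; exact: sG.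
- by move=> a b h /sG Ga /sG Gb Gh; apply: (sm_shd S) => // j; exact: sG.
Qed.

Lemma same_cons V V' (st : str V) (st' : str V') f (G : V -> Prop) (G' : V' -> Prop) :
  (forall a, G a -> G' (f a)) -> same st st' f G -> cons st' G' -> cons st G.
Proof.
move=> sG S C; split.
- move=> a b h Ga Gb Gh; rewrite -!(sm_col S) //.
  by apply: (co_sym C); [exact: sG|exact: sG|move=> j; exact/sG].
- move=> a b c h Ga Gb Gc Gh; rewrite -!(sm_col S) // -!(sm_so S) //.
  by apply: (co_tri C); [exact: sG|exact: sG|exact: sG|move=> j; exact/sG].
- move=> e a b d h Ga Gb Gd Gh; rewrite -!(sm_col S) // -!(sm_so S) // -!(sm_grn S) //.
  by apply: (co_grn C); [exact: sG|exact: sG|exact: sG|move=> j; exact/sG].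
- move=> i a b c h Ga Gb Gc Gh; rewrite /over -!(sm_grn S) // -!(sm_so S) // -!(sm_shd S) //.
  by apply: (co_shd C); [exact: sG|exact: sG|exact: sG|move=> j; exact/sG].
Qed.

Lemma prp_codom_uniq (V : eqType) (st : str V) h : prp st h -> uniq (codom h).
Proof.
move=> /forallP P; rewrite map_inj_uniq ?enum_uniq // => i j E.
by have := P i; rewrite E (eqP (P j)) => /eqP [].
Qed.

Definition sided (s : sort_t) : bool := if s is inr (inr _) then true else false.

(** A side tuple has distinct entries, of sorts that no other point has, so it always takes up k
    places of its own in a face. *)
Lemma noroom (V : eqType) (st : str V) h (l F : seq V) : prp st h ->
  uniq l -> all (fun x => ~~ sided (so st x)) l ->
  {subset l <= F} -> (forall j, h j \in F) ->
  uniq (l ++ codom h) /\ {subset l ++ codom h <= F}.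
Proof.
move=> P Ul Sl lF hF; split.
  rewrite cat_uniq Ul (prp_codom_uniq P) andbT /=; apply/hasPn => x /codomP [j ->].
  by apply/negP => /(allP Sl); rewrite (eqP (forallP P j)).
by move=> x; rewrite mem_cat => /orP[/lF //|/codomP [j ->]].
Qed.

Lemma size_noroom (V : eqType) (st : str V) h (l F : seq V) : prp st h ->
  uniq l -> all (fun x => ~~ sided (so st x)) l ->
  {subset l <= F} -> (forall j, h j \in F) -> size l + k <= size F.
Proof.
move=> P Ul Sl lF hF; have [U S] := noroom P Ul Sl lF hF.
have -> : size l + k = size (l ++ codom h) by rewrite size_cat size_codom card_ord.
exact: uniq_leq_size.
Qed.

(** Two further points next to the k side points already fill the k + 2 places. *)
Lemma full_face (V : eqType) (st : str V) h (F : seq V) b c x : prp st h ->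
  b != c -> ~~ sided (so st b) -> ~~ sided (so st c) ->
  b \in F -> c \in F -> (forall j, h j \in F) -> size F <= k.+2 -> x \in F ->
  [\/ x = b, x = c | exists j, x = h j].
Proof.
move=> P ne sb sc bF cF hF sF.
have Ul : uniq [:: b; c] by rewrite /= inE ne.
have Sl : all (fun x => ~~ sided (so st x)) [:: b; c] by rewrite /= sb sc.
have lF : {subset [:: b; c] <= F} by move=> y; rewrite !inE => /orP[] /eqP ->.
have [U S] := noroom P Ul Sl lF hF.
have sz : size F <= size ([:: b; c] ++ codom h) by rewrite size_cat size_codom card_ord.
have [_ <-] := uniq_min_size U S sz; rewrite mem_cat !inE -orbA.
by case/or3P => [/eqP ->|/eqP ->|/codomP [j ->]]; [exact: Or31|exact: Or32|apply: Or33; exists j].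
Qed.

(** This is how a face that contains a base is seen to hold no apex and no second base. *)
Lemma full_base (V : eqType) (st : str V) h (F : seq V) b c x : prp st h ->
  so st b = base false -> so st c = base true ->
  b \in F -> c \in F -> (forall j, h j \in F) -> size F <= k.+2 -> x \in F ->
  [\/ x = b, x = c | exists j, x = h j].
Proof.
move=> P sb sc; apply: (full_face P); rewrite ?sb ?sc //.
by apply/eqP => E; rewrite E sc in sb.
Qed.

End Structures.

(** * Adding a point *)

Section Extension.
Variable k : nat.
Local Notation J := ('I_k).
Local Notation sort_t := ('I_4 + (bool + 'I_k))%type.
Local Notation apex i := (inl i : sort_t).
Local Notation base e := (inr (inl e) : sort_t).

(* Apexes of different tints over a base are joined by limit edges, unless no new
   tint can be asked for over that base any more.  This is what makes a fresh limit
   edge harmless: all other edges of its red triangles are limit edges too. *)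
Definition saturation (st : str k nat) (m : nat) : Prop :=
  forall a a' b c h, a < m -> a' < m -> b < m -> c < m -> (forall j, h j < m) ->
  so st a != so st a' -> over st a b c h -> over st a' b c h ->
  col st a a' h = None \/
  forall i, i \in shd st b c h ->
    exists x, [/\ x < m, so st x = apex i & over st x b c h].

Definition good st m := cons st (fun x => x < m) /\ saturation st m.

Variables (st tau : str k nat) (m : nat) (F : seq nat).
Hypothesis st_good : good st m.
Hypothesis sizeF : size F <= k.+2.
Hypothesis Fm : forall x, x \in F -> x < m.
Hypothesis tau_cons : cons tau (fun x => x \in m :: F).
Hypothesis agree : same st tau id (fun x => x \in F).
Hypothesis new_tint : forall b c h w, b \in F -> c \in F -> (forall j, h j \in F) ->
  over tau m b c h -> w < m -> so st w = so tau m -> ~ over st w b c h.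

(* Labels avoiding the new point [m] are kept and those inside the extended face
   [m :: F] are prescribed by [tau]; only the remaining ones are chosen here. *)
Let old a b (h : J -> nat) := [&& a != m, b != m & [forall j, h j != m]].
Let dem a b (h : J -> nat) :=
  [&& a \in m :: F, b \in m :: F & [forall j, h j \in m :: F]].
Let so' x := if x == m then so tau m else so st x.
Let gr' a b h :=
  if old a b h then gr0 st a b h else dem a b h && gr0 tau a b h.
Let st1 := Str so' gr' (fun _ _ _ => None) (fun _ _ _ => finset.set0).
Let obs e a b h :=
  `[< exists d, [/\ d <= m, grn st1 e a d h & grn st1 e b d h] >].
(** White is preferred because a white edge lies in no red triangle; the limit is left for pairs at
    which both kinds of white are obstructed. *)
Let co' a b h : color :=
  if old a b h then co0 st a b h else if dem a b h then co0 tau a b h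
  else if ~~ obs false a b h then white false
  else if ~~ obs true a b h then white true else None.
(** A base that arises outside the prescribed part allows just the tints already present over it, so
    [saturation] holds there by definition. *)
Let sh' b c h : {set 'I_4} :=
  if old b c h then sh0 st b c h else if dem b c h then sh0 tau b c h
  else [set i | `[< exists x, [/\ x <= m, so' x = apex i & over st1 x b c h] >]].
Definition ext_str := Str so' gr' co' sh'.
Local Notation st' := ext_str.

Let oldP a b h : a < m -> b < m -> (forall j, h j < m) -> old a b h.
Proof. by move=> ? ? H; rewrite /old !neq_ltn; apply/and3P; split; try apply/orP; auto;
  apply/forallP => j; rewrite neq_ltn H. Qed.

Let demP a b h : a \in m :: F -> b \in m :: F -> (forall j, h j \in m :: F) -> dem a b h.
Proof. by move=> ? ? H; apply/and3P; split=> //; apply/forallP. Qed.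

Let so_old x : x < m -> so st' x = so st x.
Proof. by rewrite /= /so' => /ltn_eqF ->. Qed.

Let so_dem x : x \in m :: F -> so st' x = so tau x.
Proof.
rewrite /= /so'; case: eqVneq => [->//|ne]; rewrite inE (negbTE ne) /= => xF.
by rewrite (sm_so agree xF).
Qed.

Let prp_old h : (forall j, h j < m) -> prp st' h = prp st h.
Proof. by move=> H; apply: eq_forallb => j; rewrite so_old. Qed.
Let prp_dem h : (forall j, h j \in m :: F) -> prp st' h = prp tau h.
Proof. by move=> H; apply: eq_forallb => j; rewrite so_dem. Qed.

Let same_old : same st st' id (fun x => x < m).
Proof.
split.
- exact: so_old.
- move=> e a b h am bm hm; rewrite /grn !so_old // prp_old //.
  by rewrite /= /gr' oldP.
- move=> a b h am bm hm; rewrite /col !so_old // prp_old //.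
  by rewrite /= /co' oldP.
- move=> a b h am bm hm; rewrite /shd !so_old // prp_old //.
  by rewrite /= /sh' oldP.
Qed.

Let oldF a b h : a \in m :: F -> b \in m :: F -> (forall j, h j \in m :: F) ->
  old a b h -> [/\ a \in F, b \in F & forall j, h j \in F].
Proof.
move=> aG bG hG /and3P [am bm /forallP hm].
move: aG bG; rewrite !inE (negbTE am) (negbTE bm) /= => aF bF; split=> // j.
by have := hG j; rewrite inE (negbTE (hm j)).
Qed.

Let FmG (h : J -> nat) : (forall j, h j \in F) -> forall j, h j < m.
Proof. by move=> H j; exact/Fm. Qed.

Let same_dem : same tau st' id (fun x => x \in m :: F).
Proof.
split.
- exact: so_dem.
- move=> e a b h aG bG hG; case: (boolP (old a b h)) => [o|/negbTE o].
    have [aF bF hF] := oldF aG bG hG o.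
    by rewrite (sm_grn same_old) -?(sm_grn agree) //; [exact: Fm|exact: Fm|exact: FmG].
  by rewrite /grn !so_dem // prp_dem //= /gr' o demP.
- move=> a b h aG bG hG; case: (boolP (old a b h)) => [o|/negbTE o].
    have [aF bF hF] := oldF aG bG hG o.
    by rewrite (sm_col same_old) -?(sm_col agree) //; [exact: Fm|exact: Fm|exact: FmG].
  by rewrite /col !so_dem // prp_dem //= /co' o demP.
- move=> a b h aG bG hG; case: (boolP (old a b h)) => [o|/negbTE o].
    have [aF bF hF] := oldF aG bG hG o.
    by rewrite (sm_shd same_old) -?(sm_shd agree) //; [exact: Fm|exact: Fm|exact: FmG].
  by rewrite /shd !so_dem // prp_dem //= /sh' o demP.
Qed.

Let grn_new e a b h : grn st' e a b h -> ~~ old a b h -> dem a b h.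
Proof. by case/and4P => _ _ _; rewrite /= /gr' => H /negbTE o; move: H; rewrite o => /andP[]. Qed.

Let demE a b h : dem a b h -> [/\ a \in m :: F, b \in m :: F & forall j, h j \in m :: F].
Proof. by case/and3P => ? ? /forallP. Qed.

Let nold a b h : [\/ a = m, b = m | exists j, h j = m] -> ~~ old a b h.
Proof.
rewrite /old; case=> [->|->|[j hj]]; rewrite ?eqxx //= ?andbF //.
by rewrite !negb_and; apply/orP; right; apply/orP; right; apply/forallPn; exists j; rewrite hj eqxx.
Qed.

Let oldN a b h : ~~ old a b h -> [\/ a = m, b = m | exists j, h j = m].
Proof.
rewrite /old !negb_and !negbK => /or3P [/eqP ->|/eqP ->|/forallPn [j]].
- exact: Or31. - exact: Or32.
by rewrite negbK => /eqP ?; apply: Or33; exists j.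
Qed.

Let ltm x : x <= m -> x != m -> x < m.
Proof. by move=> l n; rewrite ltn_neqAle n. Qed.

Let apex_base_neq (s : str k nat) x y e : is_apex (so s x) -> so s y = base e -> x != y.
Proof. by move=> A B; apply/eqP => E; rewrite E B in A. Qed.

Let no_apex x b c h : b \in F -> c \in F -> (forall j, h j \in F) -> prp st' h ->
  so st' b = base false -> so st' c = base true -> is_apex (so st' x) -> x \notin F.
Proof.
move=> bF cF hF P sb sc sx; apply/negP => /(full_base P sb sc bF cF hF sizeF).
by case=> [E|E|[j E]]; move: sx; rewrite E ?sb ?sc ?(eqP (forallP P j)).
Qed.

Let base_uniq b b' c c' h : b \in F -> b' \in F -> c \in F -> c' \in F ->
  (forall j, h j \in F) -> prp st' h -> so st' b = base false -> so st' b' = base false ->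
  so st' c = base true -> so st' c' = base true -> b = b' /\ c = c'.
Proof.
move=> bF b'F cF c'F hF P sb sb' sc sc'.
have H := full_base P sb sc bF cF hF sizeF.
split.
  by case: (H _ b'F) => [->//|E|[j E]]; move: sb'; rewrite E ?sc ?(eqP (forallP P j)).
by case: (H _ c'F) => [E|->//|[j E]]; move: sc'; rewrite E ?sb ?(eqP (forallP P j)).
Qed.

Let inF x : x \in m :: F -> x != m -> x \in F.
Proof. by rewrite inE => /orP[->|]. Qed.

Let grn_m e d h : grn st' e m d h -> d \in F /\ forall j, h j \in F.
Proof.
move=> g; have [sm sd P] := grnP g.
have /demE [_ dG hG] := grn_new g (nold (Or31 _ _ erefl)).
split; first by apply: inF => //; rewrite eq_sym; apply: apex_base_neq sm sd.
move=> j; apply: inF => //; apply/eqP => E.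
by move/forallP: P => /(_ j) /eqP; rewrite E => E'; rewrite E' in sm.
Qed.

(** Such an edge is red only if both kinds of white are obstructed, and the two witnesses lie in the
    face because [m] has no green neighbour elsewhere. *)
Let fresh_m b h : is_red (col st' m b h) -> ~~ dem m b h ->
  col st' m b h = None /\
  exists d0 d1, [/\ over st' m d0 d1 h, over st' b d0 d1 h, d0 \in F & d1 \in F].
Proof.
move=> r nd; have [sm sb ne P] := col_red r.
have no : ~~ old m b h by apply: nold; exact: Or31.
move: r; rewrite /col sm sb ne P /= /co' (negbTE no) (negbTE nd) /obs.
case: asboolP => //= -[d0 [d0m g0 g0']].
case: asboolP => //= -[d1 [d1m g1 g1']] _.
split=> //; exists d0, d1.
have [? _] := grn_m g0; have [? _] := grn_m g1.
by split=> //; apply/andP; split.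
Qed.

(** The edges at [m] turn out to be limit edges caused by a base inside the face. Base and side
    points fill the face, so both edges come from the same base, and saturation makes the third edge
    a limit edge as well. Its other alternative would provide an apex with the tint of [m] over that
    base, against [new_tint]. *)
Let tri_m b c h : b <= m -> c <= m -> (forall j, h j <= m) ->
  ~ [/\ b \in m :: F, c \in m :: F & forall j, h j \in m :: F] ->
  is_red (col st' m b h) -> is_red (col st' b c h) -> is_red (col st' m c h) ->
  red_ok (par (so st' m) (so st' b) (so st' c)) (col st' m b h) (col st' b c h) (col st' m c h).
Proof.
move=> bm cm hm nD r1 r2 r3.
have [sm sb ne P] := col_red r1; have [_ sc ne2 _] := col_red r2.
have [_ _ ne3 _] := col_red r3.
have bltm : b < m by apply: ltm => //; apply: contraNneq ne => ->.
have cltm : c < m by apply: ltm => //; apply: contraNneq ne3 => ->.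
have hltm j : h j < m.
  apply: ltm => //; apply/eqP => E.
  by move/forallP: P => /(_ j) /eqP; rewrite E => E'; rewrite E' in sm.
have mG : m \in m :: F by rewrite inE eqxx.
(* If one edge at [m] leaves the prescribed part, so does the other: the base responsible for the
   first one fills the face and leaves no place in it for the apex [y]. *)
have aux x y : is_red (col st' m x h) -> is_red (col st' m y h) -> ~~ dem m x h -> ~~ dem m y h.
  move=> rx ry /(fresh_m rx) [_ [d0 [d1 [o _ d0F d1F]]]].
  apply/negP => /demE [_ yG _]; have [_ sy ney _] := col_red ry.
  have yF : y \in F by apply: inF => //; apply: contraNneq ney => ->.
  case/andP: (o) => g0 g1; have [_ s0 _] := grnP g0; have [_ s1 _] := grnP g1.
  by have [_ hF] := grn_m g0; move/negP: (no_apex d0F d1F hF P s0 s1 sy).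
have [nb nc] : ~~ dem m b h /\ ~~ dem m c h.
  case: (boolP (dem m b h)) => [/demE [_ bG hG]|nb]; last by split=> //; exact: aux nb.
  case: (boolP (dem m c h)) => [/demE [_ cG _]|nc]; first by case: nD.
  by have := aux _ _ r3 r1 nc => /negP []; apply: demP.
have [-> [d0 [d1 [o ob d0F d1F]]]] := fresh_m r1 nb.
have [-> [d0' [d1' [o' oc d0F' d1F']]]] := fresh_m r3 nc.
case/andP: (o) => g0 g1; have [_ s0 _] := grnP g0; have [_ s1 _] := grnP g1.
case/andP: (o') => g0' g1'; have [_ s0' _] := grnP g0'; have [_ s1' _] := grnP g1'.
have [_ hF] := grn_m g0.
have [E0 E1] := base_uniq d0F d0F' d1F d1F' hF P s0 s0' s1 s1'.
move: oc; rewrite -E0 -E1 => oc {o' E0 E1 d0F' d1F' g0' g1' s0' s1'}.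
have d0m := Fm d0F; have d1m := Fm d1F.
have [_ Sat] := st_good.
have := Sat b c d0 d1 h bltm cltm d0m d1m hltm.
rewrite -!so_old // => /(_ ne2).
move: ob oc; rewrite /over !(sm_grn same_old) // => ob oc /(_ ob oc).
rewrite (sm_col same_old) // => -[->|sat]; first by left.
exfalso.
have d0G : d0 \in m :: F by rewrite inE d0F orbT.
have d1G : d1 \in m :: F by rewrite inE d1F orbT.
have hG j : h j \in m :: F by rewrite inE hF orbT.
have ot : over tau m d0 d1 h by move: o; rewrite /over !(sm_grn same_dem).
move: sm; case Em : (so st' m) => [i|//] _.
have smt : so tau m = apex i by rewrite -so_dem.
have : i \in shd st d0 d1 h.
  by rewrite -(sm_shd agree) //; apply: (co_shd tau_cons) ot.
case/sat => x [xm sx ox].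
by apply: (new_tint d0F d1F hF ot xm) ox; rewrite sx smt.
Qed.

Let split_args a b c (h : J -> nat) : a <= m -> b <= m -> c <= m -> (forall j, h j <= m) ->
  [\/ [/\ a < m, b < m, c < m & forall j, h j < m],
      [/\ a \in m :: F, b \in m :: F, c \in m :: F & forall j, h j \in m :: F] |
      [\/ a = m, b = m, c = m | exists j, h j = m] /\
      ~ [/\ a \in m :: F, b \in m :: F, c \in m :: F & forall j, h j \in m :: F]].
Proof.
move=> am bm cm hm.
case: (pselect [/\ a \in m :: F, b \in m :: F, c \in m :: F & forall j, h j \in m :: F]) => D.
  exact: Or32.
have [?|na] := eqVneq a m; first by apply: Or33; split=> //; exact: Or41.
have [?|nb] := eqVneq b m; first by apply: Or33; split=> //; exact: Or42.
have [?|nc] := eqVneq c m; first by apply: Or33; split=> //; exact: Or43.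
case: (boolP [forall j, h j != m]) => [/forallP nh|/forallPn [j]].
  by apply: Or31; split; [exact: ltm|exact: ltm|exact: ltm|move=> j; apply: ltm].
by rewrite negbK => /eqP ?; apply: Or33; split=> //; apply: Or44; exists j.
Qed.

Let sym' a b (h : J -> nat) : a <= m -> b <= m -> (forall j, h j <= m) ->
  col st' a b h = col st' b a h.
Proof.
have [C _] := st_good.
move=> am bm hm; case: (split_args am bm am hm).
- case=> am' bm' _ hm'.
  have E x y : x < m -> y < m -> col st' x y h = col st x y h.
    by move=> ? ?; rewrite -(sm_col same_old).
  by rewrite !E //; apply: (co_sym C).
- case=> aG bG _ hG.
  have E x y : x \in m :: F -> y \in m :: F -> col st' x y h = col tau x y h.
    by move=> ? ?; rewrite -(sm_col same_dem).
  by rewrite !E //; apply: (co_sym tau_cons).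
- case=> M D.
  have no : ~~ old a b h by apply: nold; case: M; auto using Or31, Or32, Or33.
  have no' : ~~ old b a h by apply: nold; case: M; auto using Or31, Or32, Or33.
  have nd : ~~ dem a b h by apply/negP => /demE [? ? ?]; case: D.
  have nd' : ~~ dem b a h by apply/negP => /demE [? ? ?]; case: D.
  have oE e : obs e a b h = obs e b a h.
    by rewrite /obs; congr (`[< _ >]); apply/propext; split=> -[d [? ? ?]]; exists d.
  rewrite /col /= /co' (negbTE no) (negbTE no') (negbTE nd) (negbTE nd') !oE.
  by rewrite andbCA [so' b == _]eq_sym.
Qed.

(** An obstruction over a tuple containing [m] consists of green pairs over that tuple, and all of
    these are prescribed. *)
Let side_m a b h j : h j = m -> is_red (col st' a b h) -> dem a b h.
Proof.
move=> hj r; have [sa sb ne P] := col_red r.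
have Mh : exists j, h j = m by exists j.
apply: contraTT r => nd.
have no : ~~ old a b h by apply: nold; exact: Or33.
rewrite /col sa sb ne P /= /co' (negbTE no) (negbTE nd) /obs.
case: asboolP => //= -[d [_ /grn_new ga /grn_new gb]]; case/negP: nd.
have /demE [? ? ?] := ga (nold (Or33 _ _ Mh)).
by have /demE [? ? ?] := gb (nold (Or33 _ _ Mh)); apply: demP.
Qed.

Let white_m e b d h : d <= m -> so st' m != so st' b ->
  grn st' e m d h -> grn st' e b d h -> ~ (b \in m :: F /\ forall j, h j \in m :: F) ->
  col st' m b h != white e.
Proof.
move=> dm ne gm gb D; have [sm _ P] := grnP gm; have [sb _ _] := grnP gb.
have no : ~~ old m b h by apply: nold; exact: Or31.
have nd : ~~ dem m b h by apply/negP => /demE [_ ? ?]; case: D.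
rewrite /col sm sb ne P /= /co' (negbTE no) (negbTE nd) /obs.
have E : `[< exists d, [/\ d <= m, grn st1 e m d h & grn st1 e b d h] >] = true.
  by apply/asboolP; exists d.
by clear gm gb; case: e E => E; rewrite E //; case: asboolP.
Qed.

Lemma ext_cons : cons st' (fun x => x < m.+1).
Proof.
have [C _] := st_good.
split.
- by move=> a b h am bm hm; apply: sym'.
- move=> a b c h am bm cm hm.
  case: (split_args am bm cm hm).
  + case=> am' bm' cm' hm'; rewrite !so_old //.
    by rewrite !(sm_col same_old) //; apply: (co_tri C).
  + case=> aG bG cG hG; rewrite !so_dem //.
    by rewrite !(sm_col same_dem) //; apply: (co_tri tau_cons).
  case=> M D r1 r2 r3.
  have [sa sb ne P] := col_red r1; have [_ sc ne2 _] := col_red r2.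
  have [_ _ ne3 _] := col_red r3.
  case: M => [E|E|E|[j hj]].
  + subst a; apply: tri_m => //; case=> bG cG hG; apply: D; split=> //; exact: mem_head.
  + subst b; rewrite parC (sym' am bm hm); apply: red_ok23.
    apply: tri_m => //; last by rewrite -sym'.
    by case=> aG cG hG; apply: D; split=> //; exact: mem_head.
  + subst c; rewrite parR (sym' am bm hm) (sym' bm cm hm) (sym' am cm hm); apply: red_okC.
    by apply: tri_m; rewrite 1?sym' // => -[bG aG hG]; apply: D; split=> //; exact: mem_head.
  + have := side_m hj r1; have := side_m hj r2 => /demE [? ? ?] /demE [? ? ?].
    by case: D; split.
- move=> e a b d h am bm dm hm.
  case: (split_args am bm dm hm).
  + case=> am' bm' dm' hm'; rewrite !so_old // !(sm_grn same_old) // (sm_col same_old) //.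
    exact: (co_grn C).
  + case=> aG bG dG hG; rewrite !so_dem // !(sm_grn same_dem) // (sm_col same_dem) //.
    exact: (co_grn tau_cons).
  case=> M D ne ga gb.
  case: M => [E|E|E|Mh].
  + subst a; apply: (white_m dm ne ga gb) => -[bG hG]; apply: D.
    by have [dF _] := grn_m ga; split=> //; [exact: mem_head|rewrite inE dF orbT].
  + subst b; rewrite eq_sym in ne; rewrite (sym' am bm hm).
    apply: (white_m dm ne gb ga) => -[aG hG]; apply: D.
    by have [dF _] := grn_m gb; split=> //; [exact: mem_head|rewrite inE dF orbT].
  + have := grn_new gb (nold (Or32 _ _ E)); have := grn_new ga (nold (Or32 _ _ E)).
    by move=> /demE [? ? ?] /demE [? ? ?]; case: D; split.
  + have := grn_new gb (nold (Or33 _ _ Mh)); have := grn_new ga (nold (Or33 _ _ Mh)).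
    by move=> /demE [? ? ?] /demE [? ? ?]; case: D; split.
- move=> i a b c h am bm cm hm.
  case: (split_args am bm cm hm).
  + case=> am' bm' cm' hm'; rewrite !so_old // /over !(sm_grn same_old) // (sm_shd same_old) //.
    exact: (co_shd C).
  + case=> aG bG cG hG; rewrite !so_dem // /over !(sm_grn same_dem) // (sm_shd same_dem) //.
    exact: (co_shd tau_cons).
  case=> M D sa o.
  have [nd no] : ~~ dem b c h /\ ~~ old b c h.
    case/andP: o => /grn_new g0 /grn_new g1.
    case: (boolP (dem b c h)) => [/demE [bG cG hG]|nd].
      exfalso; apply: D; split=> //.
      case: M => [->|E|E|Mh]; first exact: mem_head.
      - by have /demE [] := g0 (nold (Or32 _ _ E)).
      - by have /demE [] := g1 (nold (Or32 _ _ E)).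
      - by have /demE [] := g0 (nold (Or33 _ _ Mh)).
    split=> //; apply: contraNN nd => /and3P [nb nc /forallP nh].
    case: M => [E|E|E|[j E]].
    + have /demE [? ? ?] := g0 (nold (Or31 _ _ E)).
      by have /demE [? ? ?] := g1 (nold (Or31 _ _ E)); apply: demP.
    + by rewrite E eqxx in nb.
    + by rewrite E eqxx in nc.
    + by have := nh j; rewrite E eqxx.
  case/andP: (o) => G0 G1; have [_ sb P] := grnP G0; have [_ sc _] := grnP G1.
  rewrite /shd sb sc P !eqxx /= /sh' (negbTE no) (negbTE nd) inE.
  by apply/asboolP; exists a.
Qed.

(** Over an old base, a new apex is joined by limit edges to the apexes of other tints. A prescribed
    base that involves [m] has no room for two apexes, by counting. Over any other base the allowed
    tints are those already present. *)
Lemma ext_saturation : saturation st' m.+1.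
Proof.
have [_ Sat] := st_good.
have apex_m a' b c h : a' <= m -> so st' m != so st' a' -> over st' m b c h ->
    over st' a' b c h -> col st' m a' h = None.
  move=> am ne o o'.
  case/andP: (o) => g0 g1; have [sm s0 P] := grnP g0; have [_ s1 _] := grnP g1.
  case/andP: (o') => g0' g1'; have [sa' _ _] := grnP g0'.
  have [bF hF] := grn_m g0; have [cF _] := grn_m g1.
  have nm : a' != m by apply: contraNneq ne => ->.
  have nd : ~~ dem m a' h.
    apply/negP => /demE [_ /inF/(_ nm) aF _].
    by move/negP: (no_apex bF cF hF P s0 s1 sa').
  have no : ~~ old m a' h by apply: nold; exact: Or31.
  rewrite /col sm sa' ne P /= /co' (negbTE no) (negbTE nd) /obs.
  have E0 : obs false m a' h by apply/asboolP; exists b; split=> //; exact/ltnW/Fm.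
  have E1 : obs true m a' h by apply/asboolP; exists c; split=> //; exact/ltnW/Fm.
  by move: E0 E1; rewrite /obs => -> ->.
move=> a a' b c h am a'm bm cm hm ne o o'.
case: (boolP (old b c h)) => [/and3P [nb nc /forallP nh]|no].
  have [bm' cm'] : b < m /\ c < m by split; apply: ltm.
  have hm' j : h j < m by exact: ltm (hm j) (nh j).
  have [Ea|na] := eqVneq a m.
    by left; subst a; apply: (apex_m a' b c).
  have [Ea|na'] := eqVneq a' m.
    by left; subst a'; rewrite sym' //; apply: (apex_m a b c) => //; rewrite eq_sym.
  have alt := ltm am na; have alt' := ltm a'm na'.
  move: ne o o'; rewrite !so_old // /over !(sm_grn same_old) // => ne o o'.
  rewrite (sm_col same_old) // (sm_shd same_old) //.
  case: (Sat a a' b c h alt alt' bm' cm' hm' ne o o') => [->|S]; first by left.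
  right=> i /S [x [xm sx ox]]; exists x; rewrite so_old // !(sm_grn same_old) //.
  by split=> //; exact: ltnW.
have M := oldN no.
case/andP: (o) => g0 g1; have [sa sb P] := grnP g0; have [_ sc _] := grnP g1.
case: (boolP (dem b c h)) => [/demE [bG cG hG]|nd].
  have inG x : over st' x b c h -> x \in m :: F.
    case/andP => /grn_new G0 /grn_new G1; case: M => [E|E|E].
    - by have /demE [] := G0 (nold (Or32 _ _ E)).
    - by have /demE [] := G1 (nold (Or32 _ _ E)).
    - by have /demE [] := G0 (nold (Or33 _ _ E)).
  have aG := inG _ o; have a'G := inG _ o'.
  case/andP: (o') => G0 _; have [sa' _ _] := grnP G0.
  have : size [:: a; a'; b; c] + k <= size (m :: F).
    apply: (size_noroom P) => //.
    - rewrite /= !inE !negb_or (apex_base_neq sa sb) (apex_base_neq sa sc).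
      rewrite (apex_base_neq sa' sb) (apex_base_neq sa' sc) !andbT /=.
      apply/andP; split; first by apply: contraNneq ne => ->.
      by apply/eqP => E; rewrite E sc in sb.
    - by move: sa sa' sb sc => /=; case: (so' a) => // ? _; case: (so' a') => // ? _ -> ->.
    - by move=> w; rewrite 4!in_cons in_nil orbF => /or4P[] /eqP ->.
  by rewrite /= !addSn add0n ltnS => /leq_trans /(_ sizeF); rewrite ltnn.
right=> i; rewrite /shd sb sc P !eqxx /= /sh' (negbTE no) (negbTE nd) inE.
by move=> /asboolP [x [xm sx ox]]; exists x.
Qed.

Lemma ext_old : same st st' id (fun x => x < m).
Proof. exact: same_old. Qed.

Lemma ext_dem : same tau st' id (fun x => x \in m :: F).
Proof. exact: same_dem. Qed.

End Extension.

(** * One-point amalgamation over a face, with or without a new point *)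

Section Limit.
Variable k : nat.
Local Notation sort_t := ('I_4 + (bool + 'I_k))%type.
Local Notation apex i := (inl i : sort_t).
Local Notation base e := (inr (inl e) : sort_t).

(** [None] stands for the point to be added to the face [F]. *)
Definition pointed (F : seq nat) (x : option nat) : Prop := x \in None :: map Some F.

Lemma pointed_some F x : pointed F (Some x) <-> x \in F.
Proof. by rewrite /pointed inE mem_map //; exact: Some_inj. Qed.

Lemma same_idC V (st st' : str k V) G : same st st' id G -> same st' st id G.
Proof.
case=> H1 H2 H3 H4; split=> [a Ga|e a b h Ga Gb Gh|a b h Ga Gb Gh|a b h Ga Gb Gh].
- exact/esym/H1. - exact/esym/H2. - exact/esym/H3. - exact/esym/H4.
Qed.

(** An isolated base point is added. This lets the stages increase strictly, so that every natural
    number becomes a point of the limit structure. *)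
Lemma grow (st : str k nat) m : good st m ->
  exists st', good st' m.+1 /\ same st st' id (fun x => x < m).
Proof.
move=> g.
pose tau : str k nat := Str (fun=> base false) (fun _ _ _ => false)
  (fun _ _ _ => None) (fun _ _ _ => finset.set0).
have tc : cons tau (fun x => x \in [:: m]) by split.
have ag : same st tau id (fun x => x \in [::]) by split.
exists (ext_str st tau m [::]); split; first split.
- by apply: ext_cons.
- by apply: ext_saturation.
- by apply: ext_old.
Qed.

(* The type of an apex over a base of k + 2 points is determined by its tint. *)
Lemma reuse (st : str k nat) F (tau : str k (option nat)) b c h w :
  size F <= k.+2 -> same st tau Some (fun x => x \in F) ->
  b \in F -> c \in F -> (forall j, h j \in F) ->
  over tau None (Some b) (Some c) (Some \o h) -> so st w = so tau None ->
  over st w b c h ->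
  w \notin F /\ same tau st (odflt w) (pointed F).
Proof.
move=> sF ag bF cF hF o sw o'.
case/andP: (o) => g0 g1; have [sN sb P] := grnP g0; have [_ sc _] := grnP g1.
case/andP: (o') => g0' g1'; have [sw' sb' P'] := grnP g0'; have [_ sc' _] := grnP g1'.
have full := full_base P' sb' sc' bF cF hF sF.
have noA x : x \in F -> is_apex (so st x) -> False.
  by move=> /full [E|E|[j E]]; rewrite E ?sb' ?sc' ?(eqP (forallP P' j)).
have sov x : pointed F x -> so st (odflt w x) = so tau x.
  by case: x => [x /pointed_some xF|_] //=; rewrite (sm_so ag).
have prpv f : (forall j, pointed F (f j)) -> prp st (odflt w \o f) = prp tau f.
  by move=> fF; apply: eq_forallb => j /=; rewrite sov.
have someP f : (forall j, pointed F (f j)) -> prp tau f ->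
    exists2 f', (forall j, f' j \in F) & f = Some \o f'.
  move=> fF Pf; have nN j : exists x, f j = Some x.
    case E : (f j) => [x|]; first by exists x.
    by move/forallP: Pf => /(_ j) /eqP; rewrite E => E'; rewrite E' in sN.
  exists (odflt w \o f).
    by move=> j /=; have [x E] := nN j; rewrite E; apply/pointed_some; rewrite -E.
  by apply/funext => j /=; have [x ->] := nN j.
split; first by apply/negP => /noA; exact.
split.
- exact: sov.
- move=> e x y f xF yF fF.
  case: (boolP [&& is_apex (so tau x), so tau y == base e & prp tau f]); last first.
    move=> N; rewrite /grn !sov // prpv //; move: N.
    by case: (is_apex _); case: (_ == _); case: (prp _ _).
  case/and3P => sx /eqP sy Pf; have [f' f'F ff] := someP f fF Pf; subst f.
  case: y yF sy => [y|]; last by move=> _ E; rewrite E in sN.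
  move/pointed_some => yF sy; case: x xF sx => [x /pointed_some xF|_] sx.
    by rewrite /= (sm_grn ag).
  have E : f' = h.
    apply/funext => j; have := eqP (forallP Pf j); rewrite /= (sm_so ag) // => E.
    case: (full _ (f'F j)) => [E'|E'|[j' E']]; move: E; rewrite E' ?sb' ?sc' //.
    by rewrite (eqP (forallP P' j')) => -[->].
  subst f'; move: sy; rewrite (sm_so ag) // => sy.
  have -> : y = if e then c else b.
    case: (full _ yF) sy => [->|->|[j ->]]; rewrite ?sb' ?sc' ?(eqP (forallP P' j)) //.
    - by case=> <-. - by case=> <-.
  by case: (e); [rewrite g1 -[RHS]g1'|rewrite g0 -[RHS]g0'].
- move=> x y f xF yF fF.
  case: (boolP [&& is_apex (so tau x), is_apex (so tau y), so tau x != so tau y & prp tau f]);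
    last first.
    by move=> /negbTE N; rewrite /col !sov // prpv // N.
  case/and4P => sx sy ne Pf; have [f' f'F ff] := someP f fF Pf; subst f.
  case: x xF sx ne => [x /pointed_some xF|_] sx ne.
    by exfalso; apply: (noA x) => //; rewrite -(sm_so ag).
  case: y yF sy ne => [y /pointed_some yF|_] sy ne.
    by exfalso; apply: (noA y) => //; rewrite -(sm_so ag).
  by rewrite eqxx in ne.
- move=> x y f xF yF fF.
  case: (boolP [&& so tau x == base false, so tau y == base true & prp tau f]); last first.
    by move=> /negbTE N; rewrite /shd !sov // prpv // N.
  case/and3P => /eqP sx /eqP sy Pf; have [f' f'F ff] := someP f fF Pf; subst f.
  case: x xF sx => [x /pointed_some xF|_] sx; last by rewrite sx in sN.
  case: y yF sy => [y /pointed_some yF|_] sy; last by rewrite sy in sN.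
  by rewrite /= (sm_shd ag).
Qed.

(** If an apex of the right tint already lies over the base in question, it is returned by [reuse];
    otherwise the condition [new_tint] of the extension holds. *)
Lemma amalgam (st : str k nat) m F (tau : str k (option nat)) :
  good st m -> size F <= k.+2 -> (forall x, x \in F -> x < m) ->
  cons tau (pointed F) -> same st tau Some (fun x => x \in F) ->
  exists st' m', [/\ good st' m', m <= m', same st st' id (fun x => x < m) &
    exists d, [/\ d < m', d \notin F & same tau st' (odflt d) (pointed F)]].
Proof.
move=> g sF Fm tc ag.
case: (pselect (exists b c h w, [/\ b \in F, c \in F, forall j, h j \in F &
    [/\ over tau None (Some b) (Some c) (Some \o h), w < m, so st w = so tau None
      & over st w b c h]])) => [|new].
  case=> b [c [h [w [bF cF hF [o wm sw o']]]]].
  exists st, m; split=> //; exists w.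
  by have [wF S] := reuse sF ag bF cF hF o sw o'.
(* Turns a structure whose new point is called [None] into one whose new point is [m]. *)
pose phi x := if x == m then None else Some x.
have phiF x : x \in F -> phi x = Some x by move=> /Fm /ltn_eqF; rewrite /phi => ->.
have phim : phi m = None by rewrite /phi eqxx.
pose tn := pull phi tau.
have phiG x : x \in m :: F -> pointed F (phi x).
  rewrite inE => /orP[/eqP ->|xF]; first by rewrite phim; exact: mem_head.
  by rewrite phiF //; apply/pointed_some.
have tnc : cons tn (fun x => x \in m :: F) by apply: same_cons phiG _ tc; exact: same_pull.
have agn : same st tn id (fun x => x \in F).
  apply: same_pullr; apply: same_ext ag => x xF /=; exact/esym/phiF.
have nt b c h w : b \in F -> c \in F -> (forall j, h j \in F) ->
    over tn m b c h -> w < m -> so st w = so tn m -> ~ over st w b c h.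
  move=> bF cF hF o wm sw o'; apply: new; exists b, c, h, w; split=> //.
  have E : phi \o h = Some \o h by apply/funext => j; exact: phiF.
  split=> //; last by rewrite -phim.
  move: o; rewrite /over /tn.
  by rewrite -![grn (pull _ _) _ _ _ _](sm_grn (same_pull phi tau (fun=> True))) //
    phim !phiF // E.
exists (ext_str st tn m F), m.+1; split=> //.
- by split; [exact: ext_cons|exact: ext_saturation].
- exact: ext_old.
exists m; split=> //; first by apply/negP => /Fm; rewrite ltnn.
have S1 : same tau tn (odflt m) (pointed F).
  apply: same_pullr; apply: same_ext (same_refl _ _) => -[x /pointed_some xF|_] /=.
    by rewrite phiF.
  by rewrite phim.
apply: (same_trans _ S1 (ext_dem Fm agn)).
by case=> [x /pointed_some xF|_]; rewrite /= inE ?eqxx // xF orbT.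
Qed.

End Limit.

(** * Enumeration of the extension problems and the limit structure *)

Section Schedule.
Variable k : nat.
Local Notation J := ('I_k).
Local Notation sort_t := ('I_4 + (bool + 'I_k))%type.
Local Notation base e := (inr (inl e) : sort_t).
Local Notation side j := (inr (inr j) : sort_t).
Local Notation I := ('I_k.+3).
Local Notation args := (I * I * {ffun J -> I})%type.

(** A face of at most k + 2 points and the point to be added fit into k + 3 indices, so extension
    problems can be coded in a countable type. *)
Definition table : countType :=
  ({ffun I -> sort_t} * {ffun args -> bool} *
   {ffun args -> color} * {ffun args -> {set 'I_4}})%type.

Definition table_str (t : table) : str k I :=
  let: (t1, t2, t3, t4) := t in
  Str t1 (fun a b h => t2 (a, b, finfun h)) (fun a b h => t3 (a, b, finfun h))
    (fun a b h => t4 (a, b, finfun h)).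

Lemma table_strK (st : str k I) : exists t, table_str t = st.
Proof.
case: st => s g c d.
exists (finfun s, [ffun x : args => g x.1.1 x.1.2 x.2],
  [ffun x : args => c x.1.1 x.1.2 x.2], [ffun x : args => d x.1.1 x.1.2 x.2]).
have E (h : J -> I) : finfun h = h :> (J -> I) by apply/funext => j; rewrite ffunE.
congr (Str _ _ _ _).
- by apply/funext => x; rewrite ffunE.
- by apply/funext => a; apply/funext => b; apply/funext => h; rewrite ffunE /= E.
- by apply/funext => a; apply/funext => b; apply/funext => h; rewrite ffunE /= E.
- by apply/funext => a; apply/funext => b; apply/funext => h; rewrite ffunE /= E.
Qed.

Definition demand : countType := (seq nat * table)%type.

Definition demand_str (q : demand) : str k (option nat) :=
  pull (fun x => inord (index x (None :: map Some q.1))) (table_str q.2).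

Lemma demand_strK F (tau : str k (option nat)) : size F <= k.+2 ->
  exists t, same tau (demand_str (F, t)) id (pointed F).
Proof.
move=> sF; have [t Et] := table_strK (pull (fun i : I => nth None (None :: map Some F) i) tau).
exists t; rewrite /demand_str /= Et; apply: same_pullr; apply: same_pullr.
apply: same_ext (same_refl _ _) => x xF.
change (x = nth None (None :: map Some F) (inord (index x (None :: map Some F)) : I)).
rewrite inordK ?nth_index //.
move: xF; rewrite /pointed -index_mem => /leq_trans; apply.
by rewrite /= size_map.
Qed.

Definition pending (q : demand) (st : str k nat) m : Prop :=
  [/\ size q.1 <= k.+2, forall x, x \in q.1 -> x < m,
      cons (demand_str q) (pointed q.1) &
      same st (demand_str q) Some (fun x => x \in q.1)].

Definition served (q : demand) (st : str k nat) m : Prop :=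
  exists d, [/\ d < m, d \notin q.1 & same (demand_str q) st (odflt d) (pointed q.1)].

Lemma pending_ext q st m st' m' : m <= m' -> same st st' id (fun x => x < m) ->
  pending q st m -> pending q st' m'.
Proof.
move=> mm S [sF Fm C ag]; split=> //; first by move=> x /Fm /leq_trans; exact.
apply: (same_trans (f := id) (G2 := fun x => x \in q.1)) ag => //.
by apply: same_sub (same_idC S).
Qed.

Lemma served_ext q st m st' m' : m <= m' -> same st st' id (fun x => x < m) ->
  (forall x, x \in q.1 -> x < m) -> served q st m -> served q st' m'.
Proof.
move=> mm S Fm [d [dm dF Sd]]; exists d; split=> //; first exact: leq_trans mm.
by apply: same_trans Sd S => -[x /pointed_some /Fm|].
Qed.

Lemma serve_all (l : seq demand) st m : good st m ->
  exists st' m', [/\ good st' m', m < m', same st st' id (fun x => x < m) &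
    forall q, q \in l -> pending q st m -> served q st' m'].
Proof.
elim: l st m => [|q l IH] st m g.
  by have [st' [g' S]] := grow g; exists st', m.+1.
have [st1 [m1 [g1 mm1 S1 sq]]] : exists st1 m1, [/\ good st1 m1, m <= m1,
    same st st1 id (fun x => x < m) & pending q st m -> served q st1 m1].
  case: (pselect (pending q st m)) => [[sF Fm C ag]|np]; last by exists st, m.
  have [st1 [m1 [? ? ? ?]]] := amalgam g sF Fm C ag.
  by exists st1, m1.
have [st2 [m2 [g2 mm2 S2 sl]]] := IH st1 m1 g1.
exists st2, m2; split=> //; first exact: leq_ltn_trans mm2.
  by apply: same_trans S1 S2 => x /leq_trans; exact.
move=> r; rewrite inE => /orP[/eqP ->|rl] pr.
  case: (pr) => _ Fm _ _; apply: served_ext S2 _ (sq pr); first exact: ltnW.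
  by move=> x /Fm /leq_trans; exact.
by apply: sl => //; exact: pending_ext pr.
Qed.

(** A base at 0 and 1 with side points from 2 on, where all four tints are allowed: over such a base
    the contradictory four apexes will be demanded. *)
Definition init : str k nat := Str
  (fun x => if x is x'.+2 then oapp (fun j => side j) (base false) (insub x')
            else base (x == 1))
  (fun _ _ _ => false) (fun _ _ _ => None) (fun _ _ _ => finset.setT).

Lemma init_apex x : is_apex (so init x) = false.
Proof. by case: x => [|[|x]] //=; case: insub. Qed.

Lemma good_init : good init k.+2.
Proof.
split; first split.
- by move=> a b h _ _ _; rewrite /col !init_apex.
- by move=> a b c h _ _ _ _; rewrite /col init_apex.
- by move=> e a b d h _ _ _ _ _; rewrite /grn init_apex.
- by move=> i a b c h _ _ _ _; rewrite /over /grn init_apex.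
- by move=> a a' b c h _ _ _ _ _ _; rewrite /over /grn init_apex.
Qed.

(** Step n serves all demands of code at most n that are pending, so a demand is considered again at
    every later stage and is met once its face is present. *)
Lemma chain_exists : exists s : nat -> str k nat * nat,
  [/\ s 0 = (init, k.+2), forall n, good (s n).1 (s n).2, forall n, (s n).2 < (s n.+1).2,
      forall n, same (s n).1 (s n.+1).1 id (fun x => x < (s n).2) &
      forall n q, pickle q <= n -> pending q (s n).1 (s n).2 ->
        served q (s n.+1).1 (s n.+1).2].
Proof.
have step (pl : {p : str k nat * nat | good p.1 p.2} * seq demand) :
  exists p' : {p : str k nat * nat | good p.1 p.2}, let p := sval pl.1 in let p' := sval p' in
   [/\ p.2 < p'.2, same p.1 p'.1 id (fun x => x < p.2) &
    forall q, q \in pl.2 -> pending q p.1 p.2 -> served q p'.1 p'.2].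
  case: pl => [[[st m] g] l] /=; have [st' [m' [g' ? ? ?]]] := serve_all l g.
  by exists (exist _ (st', m') g').
have [f Hf] := choice step.
pose dl n : seq demand := pmap unpickle (iota 0 n.+1).
pose t := fix t n := if n is n'.+1 then f (t n', dl n') else exist _ (init, k.+2) good_init.
exists (fun n => sval (t n)); split=> //.
- by move=> n; exact: svalP (t n).
- by move=> n; case: (Hf (t n, dl n)).
- by move=> n; case: (Hf (t n, dl n)).
move=> n q qn; have [_ _] := Hf (t n, dl n); apply=> /=.
rewrite mem_pmap; apply/mapP; exists (pickle q); last by rewrite pickleK.
by rewrite mem_iota.
Qed.

Lemma cons_local (st : str k nat) : (forall n, cons st (fun x => x < n)) ->
  cons st (fun=> True).
Proof.
move=> C.
pose N (h : J -> nat) := \sum_j h j.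
have hN h j : h j <= N h by rewrite /N (bigD1 j) //= leq_addr.
split.
- move=> a b h _ _ _; apply: (co_sym (C (a + b + N h).+1));
    [lia|lia|move=> j; have := hN h j; lia].
- move=> a b c h _ _ _ _; apply: (co_tri (C (a + b + c + N h).+1));
    [lia|lia|lia|move=> j; have := hN h j; lia].
- move=> e a b d h _ _ _ _; apply: (co_grn (C (a + b + d + N h).+1));
    [lia|lia|lia|move=> j; have := hN h j; lia].
- move=> i a b c h _ _ _ _; apply: (co_shd (C (a + b + c + N h).+1));
    [lia|lia|lia|move=> j; have := hN h j; lia].
Qed.

(* Every consistent one-point extension of a face of at most [k + 2] points is
   realised: this is the only homogeneity of the structure that is used. *)
Lemma homogeneous_str : exists M : str k nat,
  [/\ cons M (fun=> True),
    forall F (tau : str k (option nat)), size F <= k.+2 -> cons tau (pointed F) ->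
      same M tau Some (fun x => x \in F) ->
      exists d, d \notin F /\ same tau M (odflt d) (pointed F) &
    [/\ so M 0 = base false, so M 1 = base true, forall j : J, so M j.+2 = side j &
      shd M 0 1 (fun j => j.+2) = finset.setT]].
Proof.
have [s [s0 sg sm sS sq]] := chain_exists.
have smn n : n <= (s n).2 by elim: n => // n /leq_ltn_trans; exact.
have mono i j : i <= j -> (s i).2 <= (s j).2 /\ same (s i).1 (s j).1 id (fun x => x < (s i).2).
  elim: j => [|j IH]; first by rewrite leqn0 => /eqP ->.
  rewrite leq_eqVlt => /orP[/eqP -> //|/IH [mm S]].
  split; first exact: leq_trans mm (ltnW (sm j)).
  by apply: same_trans S (sS j) => x /leq_trans; exact.
have both i j : same (s i).1 (s j).1 id (fun x => x < (s i).2 /\ x < (s j).2).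
  case: (leqP i j) => [|/ltnW] /mono [_ S]; first by apply: same_sub S => x [].
  by apply: same_idC; apply: same_sub S => x [].
(* A label is read off at a stage that contains all its arguments; the later stages agree with
   it. *)
pose N a b (h : J -> nat) := (a + b + \sum_j h j).+1.
pose M := Str (fun x => so (s x.+1).1 x) (fun a b h => gr0 (s (N a b h)).1 a b h)
  (fun a b h => co0 (s (N a b h)).1 a b h) (fun a b h => sh0 (s (N a b h)).1 a b h).
have hN a b h j : h j < N a b h by rewrite /N (bigD1 j) //=; lia.
have lim n : same (s n).1 M id (fun x => x < (s n).2).
  have soE i x : x < (s i).2 -> so M x = so (s i).1 x.
    by move=> xi; rewrite /= (sm_so (both i x.+1)) //; split=> //; exact: smn.
  have prpE i h : (forall j, h j < (s i).2) -> prp M h = prp (s i).1 h.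
    by move=> H; apply: eq_forallb => j; rewrite (soE i).
  have lN a b h x : x < N a b h -> x < (s (N a b h)).2 by move/leq_trans; apply.
  split.
  - by move=> x; exact: soE.
  - move=> e a b h an bn hn.
    have aN : a < (s (N a b h)).2 by apply: lN; rewrite /N; lia.
    have bN : b < (s (N a b h)).2 by apply: lN; rewrite /N; lia.
    have hN' j : h j < (s (N a b h)).2 by exact: lN.
    rewrite -(sm_grn (both n (N a b h))) //.
    by rewrite /grn !(soE (N a b h)) // (prpE (N a b h)).
  - move=> a b h an bn hn.
    have aN : a < (s (N a b h)).2 by apply: lN; rewrite /N; lia.
    have bN : b < (s (N a b h)).2 by apply: lN; rewrite /N; lia.
    have hN' j : h j < (s (N a b h)).2 by exact: lN.
    rewrite -(sm_col (both n (N a b h))) //.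
    by rewrite /col !(soE (N a b h)) // (prpE (N a b h)).
  - move=> a b h an bn hn.
    have aN : a < (s (N a b h)).2 by apply: lN; rewrite /N; lia.
    have bN : b < (s (N a b h)).2 by apply: lN; rewrite /N; lia.
    have hN' j : h j < (s (N a b h)).2 by exact: lN.
    rewrite -(sm_shd (both n (N a b h))) //.
    by rewrite /shd !(soE (N a b h)) // (prpE (N a b h)).
exists M; split.
- apply: cons_local => n; have [C _] := sg n.
  apply: (same_cons (f := id) (G' := fun x => x < (s n).2)) C.
    by move=> x /leq_trans; apply.
  by apply: same_sub (same_idC (lim n)) => x /leq_trans; apply.
- move=> F tau sF C ag; have [t St] := demand_strK tau sF.
  (* The stage must contain the face [F] and be late enough for the code of [q]. *)
  pose q : demand := (F, t); pose n := maxn (pickle q) (\sum_(x <- F) x).+1.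
  have Fn x : x \in F -> x < (s n).2.
    move=> xF; apply: leq_trans (smn n); rewrite leq_max; apply/orP; right.
    by rewrite ltnS (big_rem x) //= leq_addr.
  have pq : pending q (s n).1 (s n).2.
    split=> //.
      by apply: (same_cons (f := id)) (same_idC St) C.
    apply: (same_trans (f := id) (g := Some) (s2 := M) (G2 := fun x => x \in F)) => //; last first.
      by apply: (same_trans (f := Some) (g := id) (G2 := pointed F)) ag St => x /pointed_some.
    by apply: same_sub (lim n) => x /Fn.
  have [d [dn dF Sd]] := sq n q (leq_maxl _ _) pq.
  exists d; split=> //; apply: (same_trans (f := id) (g := odflt d) (G2 := pointed F)) St _ => //.
  apply: (same_trans (f := odflt d) (g := id)) Sd (lim n.+1) => -[x /pointed_some|//] /= /Fn /ltn_trans; apply.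
  exact: sm.
- have L := lim 0; rewrite s0 in L.
  have insubJ (j : J) : insub (j : nat) = Some j := valK j.
  have E : forall j : J, so M j.+2 = side j.
    by move=> j; rewrite -[LHS](sm_so (same_idC L)) /= ?insubJ // !ltnS.
  split=> //.
  + by rewrite -[LHS](sm_so (same_idC L)).
  + by rewrite -[LHS](sm_so (same_idC L)).
  rewrite -[LHS](sm_shd (same_idC L)) //; last by move=> j; rewrite /= !ltnS.
  rewrite /shd /=; case: ifP => // /negP[]; apply/forallP => j /=.
  by rewrite insubJ.
Qed.

End Schedule.

(** * Truncated types *)

Section Truncation.
Variable N : nat.

Definition is_big (c : color) : bool :=
  match c with None => true | red t _ => N <= t | _ => false end.

(** The value [None] gathers the limit and all reds of superscript at least [N], of both parities;
    what remains is a finite type. *)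
Definition trunc (c : color) : option (bool + 'I_N * bool) :=
  match c with
  | None => None
  | white e => Some (inl e)
  | red t e => omap (fun t' => inr (t', e)) (insub t)
  end.

Lemma trunc_bigE c : (trunc c == None) = is_big c.
Proof.
case: c => [[e|[t e]]|] //=; case: insubP => [u ltN Eu|] /=.
  by rewrite leqNgt ltN.
by rewrite -leqNgt => ->.
Qed.

Lemma trunc_big c c' : trunc c = trunc c' -> is_big c = is_big c'.
Proof. by rewrite -!trunc_bigE => ->. Qed.

Lemma big_trunc c c' : is_big c -> is_big c' -> trunc c = trunc c'.
Proof. by rewrite -!trunc_bigE => /eqP -> /eqP ->. Qed.

Lemma trunc_inj c c' : trunc c = trunc c' -> ~~ is_big c -> c = c'.
Proof.
case: c => [[e|[t e]]|] //; case: c' => [[e'|[t' e']]|] //=.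
- by case=> ->.
- by case: insubP.
- by move=> + _; case: insubP.
- rewrite -ltnNge => E ltN; move: E; rewrite insubT /=.
  by case: insubP => //= u _ <- [<- ->].
- by rewrite -ltnNge => + ltN; rewrite insubT.
Qed.

Lemma trunc_red c c' : trunc c = trunc c' -> is_red c = is_red c'.
Proof.
case: (boolP (is_big c)) => [B E|nB /trunc_inj -> //].
have := trunc_big E; rewrite B; move: B.
by case: c E => [[e|[t e]]|] //; case: c' => [[e'|[t' e']]|].
Qed.

Lemma trunc_white c c' e : trunc c = trunc c' -> c = white e -> c' = white e.
Proof. by move=> E Ec; rewrite -(trunc_inj E) // Ec. Qed.

Lemma big_red c : is_big c -> is_red c.
Proof. by case: c => [[]|]. Qed.

End Truncation.

Lemma trunc_mono N N' c c' : N <= N' -> trunc N' c = trunc N' c' -> trunc N c = trunc N c'.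
Proof.
move=> le E; case: (boolP (is_big N' c)) => [B|/(trunc_inj E) -> //].
have B' : is_big N' c' by rewrite -(trunc_big E).
have sub x : is_big N' x -> is_big N x by case: x => [[e|[t e]]|] //=; exact: leq_trans.
by apply: big_trunc; exact: sub.
Qed.

(** Exactly one of three distinct numbers is the largest. So the value [P] of a triangle can be put
    on the edge opposite its largest point, a rule that treats the three edges alike. *)
Lemma max_parity (x y z : nat) (P : bool) : x != y -> y != z -> x != z ->
  [&& x < y, z < y & P] = [&& x < z, y < z & P] (+) [&& y < x, z < x & P] (+) P.
Proof.
case: P; last by rewrite !andbF.
case: (ltngtP x y) => // xy _; case: (ltngtP y z) => // yz _; case: (ltngtP x z) => //= xz _.
- by have := ltn_trans xy yz; rewrite ltnNge ltnW.
- by have := ltn_trans yz xy; rewrite ltnNge ltnW.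
Qed.

(** * Similarity of tuples up to truncation, and back-and-forth *)

Section Similarity.
Variables (k : nat) (M : str k nat).
Local Notation J := ('I_k).
Local Notation I := ('I_k.+3).

Record sim (N : nat) (s s' : I -> nat) : Prop := Sim {
  sim_eq : forall p q, (s p == s q) = (s' p == s' q);
  sim_so : forall p, so M (s p) = so M (s' p);
  sim_grn : forall e p q g, grn M e (s p) (s q) (s \o g) = grn M e (s' p) (s' q) (s' \o g);
  sim_col : forall p q g, trunc N (col M (s p) (s q) (s \o g)) =
                          trunc N (col M (s' p) (s' q) (s' \o g));
  sim_shd : forall p q g, shd M (s p) (s q) (s \o g) = shd M (s' p) (s' q) (s' \o g) }.

Lemma sim_sym N s s' : sim N s s' -> sim N s' s.
Proof. by case=> H1 H2 H3 H4 H5; split=> *; symmetry; auto. Qed.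

Lemma sim_trans N s1 s2 s3 : sim N s1 s2 -> sim N s2 s3 -> sim N s1 s3.
Proof.
case=> a1 a2 a3 a4 a5 [b1 b2 b3 b4 b5]; split.
- by move=> *; rewrite a1 b1. - by move=> *; rewrite a2 b2.
- by move=> *; rewrite a3 b3. - by move=> *; rewrite a4 b4.
- by move=> *; rewrite a5 b5.
Qed.

Lemma sim_mono N N' s s' : N <= N' -> sim N' s s' -> sim N s s'.
Proof. by move=> le [H1 H2 H3 H4 H5]; split=> // p q g; exact: trunc_mono (H4 _ _ _). Qed.

Lemma sim_pre N s s' (f : I -> I) : sim N s s' -> sim N (s \o f) (s' \o f).
Proof.
case=> H1 H2 H3 H4 H5; split.
- by move=> p q; exact: H1. - by move=> p; exact: H2.
- by move=> e p q g; exact: (H3 e (f p) (f q) (f \o g)).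
- by move=> p q g; exact: (H4 (f p) (f q) (f \o g)).
- by move=> p q g; exact: (H5 (f p) (f q) (f \o g)).
Qed.

(** These are the tuples that lie in atoms of the algebra. *)
Definition real (s : I -> nat) : Prop :=
  forall p q g, col M (s p) (s q) (s \o g) <> None.

Lemma real_pre s (f : I -> I) : real s -> real (s \o f).
Proof. by move=> R p q g; exact: (R (f p) (f q) (f \o g)). Qed.

Definition upd (T : Type) (s : I -> T) i d : I -> T := fun p => if p == i then d else s p.

Lemma upd_same s i k' : k' != i ->
  upd s i (s k') = s \o (fun p => if p == i then k' else p) :> (I -> nat).
Proof. by move=> ne; apply/funext => p; rewrite /upd /=; case: ifP. Qed.

Hypothesis M_cons : cons M (fun=> True).
Hypothesis M_ext : forall F (tau : str k (option nat)), size F <= k.+2 ->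
  cons tau (pointed F) -> same M tau Some (fun x => x \in F) ->
  exists d, d \notin F /\ same tau M (odflt d) (pointed F).

Let colC a b h : col M a b h = col M b a h.
Proof. exact: (co_sym M_cons). Qed.

(* The back-and-forth property: given the new point [d] for [s], a type over [s'] is
   built that agrees with it up to truncation.  Only the edges of large or infinite
   superscript need new labels, and each of them lies in at most one red triangle
   because such a triangle exhausts the k + 3 points. *)
Section NewPoint.
Variables (N : nat) (s s' : I -> nat) (i : I) (d : nat).
Hypothesis s_sim : sim N s s'.
Hypothesis d_new : forall p, p != i -> s p != d.

Let sd := upd s i d.
(** The points of the extended face over [s'] are written [u p]; [phi] carries them to the entries
    of [s] with [d] put at position [i]. *)
Let u p := if p == i then None else Some (s' p).
Let F := [seq s' p | p <- enum (predC1 i)].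
Let idx x := if x is Some y then odflt i [pick p | (p != i) && (s' p == y)] else i.
Let phi x := sd (idx x).

Let sizeF : size F <= k.+2.
Proof. by rewrite size_map -cardE cardC1 card_ord. Qed.

Let memF p : p != i -> s' p \in F.
Proof. by move=> ne; apply: map_f; rewrite mem_enum. Qed.

Let phiu p : phi (u p) = sd p.
Proof.
rewrite /phi /u; case: eqVneq => [->//|ne] /=.
case: pickP => [q /andP [qi /eqP E]|/(_ p)]; last by rewrite ne eqxx.
by rewrite /sd /upd /= (negbTE qi) (negbTE ne); apply/eqP; rewrite (sim_eq s_sim) E.
Qed.

Let phiuh (g : J -> I) : phi \o (u \o g) = sd \o g.
Proof. by apply/funext => j; exact: phiu. Qed.

Let uP x : pointed F x -> exists p, x = u p.
Proof.
case: x => [x /pointed_some /mapP [p]|_].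
  by rewrite mem_enum inE /= => ne ->; exists p; rewrite /u (negbTE ne).
by exists i; rewrite /u eqxx.
Qed.

Let upt p : pointed F (u p).
Proof. by rewrite /u; case: eqVneq => [_|/memF /pointed_some //]; exact: mem_head. Qed.

Let uhP h : (forall j, pointed F (h j)) -> exists g : J -> I, h = u \o g.
Proof.
move=> H; have [g Hg] := choice (fun j => uP (H j)).
by exists g; apply/funext.
Qed.

Let cphi a b h := col M (phi a) (phi b) (phi \o h).
Let old (a b : option nat) (h : J -> option nat) := [&& isSome a, isSome b & [forall j, isSome (h j)]].
Let third a b h := [pick p | is_red (cphi a (u p) h) && is_red (cphi b (u p) h)].

(** A new apex has edges to [y] and to [z], and these must match the old edge between [y] and [z]:
    the same superscript, and parities adding up to its parity plus [P]. The order of the points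
    decides which of the two edges gets parity [false]. An old limit edge forces limits. The default
    [red N false] is still big. *)
Let copy (P : bool) y z (h : J -> nat) : color :=
  match col M y z h with
  | None => None
  | red t e => if N <= t then red t (if y < z then false else e (+) P) else red N false
  | white _ => red N false
  end.

(* The label of a new edge [a b] whose label in [s] is truncated, given the apex
   [w] that completes the face to a triangle. *)
Let mend (a b w : option nat) (h : J -> option nat) : color :=
  let P := par (so M (phi a)) (so M (phi b)) (so M (phi w)) in
  match a, b, w with
  | None, Some y, Some z => copy P y z (odflt 0 \o h)
  | Some y, None, Some z => copy P y z (odflt 0 \o h)
  | Some x, Some y, Some z => red N [&& x < z, y < z & P]
  | _, _, _ => red N false
  end.

Let fresh a b h := if third a b h is Some p then mend a b (u p) h else red N false.

Let tau : str k (option nat) := Str (so M \o phi)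
  (fun a b h => gr0 M (phi a) (phi b) (phi \o h))
  (fun a b h => if old a b h then col M (odflt 0 a) (odflt 0 b) (odflt 0 \o h)
                else if is_big N (cphi a b h) then fresh a b h else cphi a b h)
  (fun a b h => sh0 M (phi a) (phi b) (phi \o h)).

Let oldP p q (g : J -> I) : old (u p) (u q) (u \o g) ->
  [/\ p != i, q != i & forall j, g j != i].
Proof.
case/and3P; rewrite /u; case: eqVneq => // _; case: eqVneq => // _ _ _ /forallP H.
by split=> // j; have := H j; rewrite /=; case: eqVneq.
Qed.

Let u_old p : p != i -> odflt 0 (u p) = s' p.
Proof. by rewrite /u => /negbTE ->. Qed.

Let uh_old (g : J -> I) : (forall j, g j != i) -> odflt 0 \o (u \o g) = s' \o g.
Proof. by move=> H; apply/funext => j; exact: u_old. Qed.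

Let sd_old p : p != i -> sd p = s p.
Proof. by rewrite /sd /upd => /negbTE ->. Qed.

Let sdh_old (g : J -> I) : (forall j, g j != i) -> sd \o g = s \o g.
Proof. by move=> H; apply/funext => j; exact: sd_old. Qed.

Let col_old p q (g : J -> I) : old (u p) (u q) (u \o g) ->
  col tau (u p) (u q) (u \o g) = col M (s' p) (s' q) (s' \o g).
Proof.
move=> o; have [pi qi gi] := oldP o.
have P : prp tau (u \o g) = prp M (s' \o g).
  by apply: eq_forallb => j /=; rewrite phiu sd_old // (sim_so s_sim).
rewrite /col P /= o u_old // u_old // uh_old // !phiu !sd_old // !(sim_so s_sim).
by case: ifP => // E; rewrite /col E.
Qed.

Let cphiE p q (g : J -> I) : cphi (u p) (u q) (u \o g) = col M (sd p) (sd q) (sd \o g).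
Proof. by rewrite /cphi !phiu phiuh. Qed.

Let cphi_old p q (g : J -> I) : old (u p) (u q) (u \o g) ->
  trunc N (cphi (u p) (u q) (u \o g)) = trunc N (col M (s' p) (s' q) (s' \o g)).
Proof.
by move=> /oldP [pi qi gi]; rewrite cphiE !sd_old // sdh_old // (sim_col s_sim).
Qed.

Let col_new a b h : ~~ old a b h ->
  col tau a b h = if is_big N (cphi a b h) then fresh a b h else cphi a b h.
Proof.
move=> /negbTE no; rewrite {1}/col /= no.
by case: ifP => // E; rewrite /cphi /col E.
Qed.

(** A second apex completing the edge to a triangle would put four apexes and k side points among k
    + 3 points, so the choice made by [third] is forced. *)
Let thirdP p q r (g : J -> I) : is_red (cphi (u p) (u q) (u \o g)) ->
  is_red (cphi (u q) (u r) (u \o g)) -> is_red (cphi (u p) (u r) (u \o g)) ->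
  fresh (u p) (u q) (u \o g) = mend (u p) (u q) (u r) (u \o g).
Proof.
move=> r1 r2 r3; rewrite /fresh /third; case: pickP => [w /andP [w1 w2]|/(_ r)]; last by rewrite r2 r3.
have [//|ne] := eqVneq (u w) (u r); first by move=> ->.
have [a1 a2 n1 P] := col_red r1; have [_ a3 n2 _] := col_red r2.
have [_ _ n3 _] := col_red r3.
have [_ a4 n4 _] := col_red w1; have [_ _ n5 _] := col_red w2.
have neq x y : so M (phi x) != so M (phi y) -> x != y by apply: contraNneq => ->.
have : size [:: u p; u q; u r; u w] + k <= size (None :: map Some F).
  apply: (@size_noroom k _ tau (u \o g)) => //.
  - by rewrite /= !inE !negb_or (eq_sym (u r)) ne !neq.
  - rewrite /=; move: a1 a2 a3 a4.
    by do 4!(case: (so M _) => // ? _).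
  - by move=> x; rewrite 4!in_cons in_nil orbF => /or4P[] /eqP ->; exact: upt.
  - by move=> j; exact: upt.
by rewrite /= size_map !addSn add0n ltnS => /leq_trans /(_ sizeF); rewrite ltnn.
Qed.

Let mendC a b w h : mend a b w h = mend b a w h.
Proof.
rewrite /mend (parC (so M (phi a))); move: (par _ _ _) => P.
case: a => [x|]; case: b => [y|]; case: w => [z|]; try reflexivity.
by rewrite andbCA.
Qed.

Let cphiC a b h : cphi a b h = cphi b a h.
Proof. exact: colC. Qed.

Let freshC a b h : fresh a b h = fresh b a h.
Proof.
rewrite /fresh /third (eq_pick (Q := fun p => is_red (cphi b (u p) h) && is_red (cphi a (u p) h))).
  by case: pickP => // w _; exact: mendC.
by move=> p; rewrite /= andbC.
Qed.

Let fresh_big a b h : is_big N (fresh a b h).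
Proof.
have copy_big P y z g : is_big N (copy P y z g).
  rewrite /copy; case: (col _ _ _ _) => [[e|[x e]]|]; rewrite /= ?leqnn //.
  by case: (leqP N x) => /=.
rewrite /fresh; case: (third a b h) => [w|] //=; rewrite /mend.
by case: a b (u w) => [x|] [y|] [z|] //=.
Qed.

Let noside p q (g : J -> I) : is_red (cphi (u p) (u q) (u \o g)) -> p = i -> forall j, g j != i.
Proof.
move=> r E j; have [a1 _ _ P] := col_red r; apply/eqP => E'.
by move/forallP: P => /(_ j) /eqP; rewrite /= E' -E => E''; rewrite E'' in a1.
Qed.

(** Only [copy] can return the limit label, and only from a limit edge of [s']. *)
Let fresh_real p q (g : J -> I) : ~~ old (u p) (u q) (u \o g) -> real s' ->
  fresh (u p) (u q) (u \o g) <> None.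
Proof.
move=> no R; rewrite /fresh /third; case: pickP => [w /andP [w1 w2]|//].
have copyN P y z (f : J -> I) : (forall j, f j != i) ->
    copy P (s' y) (s' z) (odflt 0 \o (u \o f)) <> None.
  move=> fi; rewrite uh_old // /copy.
  case E : (col _ _ _ _) => [[e|[x e]]|] //; first by case: ifP.
  by case: (R y z f).
rewrite /mend; move: (par _ _ _) => P.
have Eu x : x != i -> u x = Some (s' x) by move=> /negbTE E; rewrite /u E.
have Ei : u i = None by rewrite /u eqxx.
have [Ep|np] := eqVneq p i.
  have gi := noside w1 Ep; rewrite Ep Ei.
  have [->|nq] := eqVneq q i; first by rewrite Ei.
  have [->|nw] := eqVneq w i; first by rewrite Ei Eu.
  by rewrite !Eu //; exact: copyN.
have [Eq|nq] := eqVneq q i.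
  have gi := noside w2 Eq; rewrite Eq Ei Eu //.
  have [->|nw] := eqVneq w i; first by rewrite Ei.
  by rewrite !Eu //; exact: copyN.
by rewrite (Eu p) // (Eu q) //; case: (u w).
Qed.

Let tauC p q (g : J -> I) : col tau (u p) (u q) (u \o g) = col tau (u q) (u p) (u \o g).
Proof.
case: (boolP (old (u p) (u q) (u \o g))) => [o|no].
  have o' : old (u q) (u p) (u \o g) by move: o; rewrite /old andbCA.
  by rewrite !col_old // colC.
have no' : ~~ old (u q) (u p) (u \o g) by move: no; rewrite /old andbCA.
by rewrite !col_new // cphiC freshC.
Qed.

Let tau_trunc p q (g : J -> I) : trunc N (col tau (u p) (u q) (u \o g)) = trunc N (cphi (u p) (u q) (u \o g)).
Proof.
case: (boolP (old (u p) (u q) (u \o g))) => [o|no]; first by rewrite col_old // cphi_old.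
rewrite col_new //; case: ifP => // B.
exact: big_trunc (fresh_big _ _ _) B.
Qed.

(** The new point is an apex here, so one edge of the triangle is old and the other two were copied
    from it. *)
Let tri_new q r (g : J -> I) : is_big N (cphi (u i) (u q) (u \o g)) ->
  is_big N (cphi (u q) (u r) (u \o g)) -> is_big N (cphi (u i) (u r) (u \o g)) ->
  red_ok (par (so M (phi (u i))) (so M (phi (u q))) (so M (phi (u r))))
    (col tau (u i) (u q) (u \o g)) (col tau (u q) (u r) (u \o g)) (col tau (u i) (u r) (u \o g)).
Proof.
move=> B1 B2 B3.
have r1 := big_red B1; have r2 := big_red B2; have r3 := big_red B3.
have gi := noside r1 erefl.
have [_ _ n1 _] := col_red r1; have [_ _ n2 _] := col_red r2; have [_ _ n3 _] := col_red r3.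
have qi : q != i by apply: contraNneq n1 => ->.
have ri : r != i by apply: contraNneq n3 => ->.
have o2 : old (u q) (u r) (u \o g).
  by rewrite /old /u (negbTE qi) (negbTE ri) /=; apply/forallP => j /=; rewrite (negbTE (gi j)).
have no x : ~~ old (u i) x (u \o g) by rewrite /old /u eqxx.
have neq : s' q != s' r.
  apply: contraNneq n2; rewrite !phiu !sd_old // !(sim_so s_sim) => ->; exact: eqxx.
rewrite (col_old o2) !(col_new (no _)) B1 B3.
rewrite (thirdP r1 r2 r3) (thirdP (r := q) r3) //; last by rewrite cphiC.
rewrite /mend; set P := par _ _ _; rewrite -/(par (so M (phi (u i))) (so M (phi (u r))) (so M (phi (u q)))).
have -> : par (so M (phi (u i))) (so M (phi (u r))) (so M (phi (u q))) = P.
  by rewrite /P parC parR parC.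
have Ei : u i = None by rewrite /u eqxx.
have Eu x : x != i -> u x = Some (s' x) by move=> /negbTE E; rewrite /u E.
rewrite Ei !Eu // uh_old // /copy [col M (s' r) _ _]colC.
have := cphi_old o2 => /trunc_big; rewrite B2.
case: (col M (s' q) (s' r) _) => [[e|[t e]]|] //=; last by left.
move=> /esym Nt; rewrite Nt; right; exists t, (if s' q < s' r then false else e (+) P), e; split=> //.
by move: neq; rewrite neq_ltn; case: (ltngtP (s' q) (s' r)) => //= _ _; case: e P => [] [].
Qed.

(** The edges of a red triangle in [M] share their superscript, so all three are below the
    truncation, where labels are kept, or all three are big. A big triangle has the new point as a
    vertex ([tri_new]), or avoids it and is copied from [s'], or has it as a side point; then all
    its edges are new, of superscript [N], with parities as in [max_parity]. *)
Lemma tau_cons : cons tau (pointed F).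
Proof.
split.
- by move=> a b h /uP [p ->] /uP [q ->] /uhP [g ->]; exact: tauC.
- move=> a b c h /uP [p ->] /uP [q ->] /uP [r ->] /uhP [g ->] r1 r2 r3.
  have T1 := tau_trunc p q g; have T2 := tau_trunc q r g; have T3 := tau_trunc p r g.
  rewrite (trunc_red T1) in r1; rewrite (trunc_red T2) in r2; rewrite (trunc_red T3) in r3.
  have ok := co_tri M_cons (h := phi \o (u \o g)) Logic.I Logic.I Logic.I (fun=> Logic.I) r1 r2 r3.
  case: (boolP (is_big N (cphi (u p) (u q) (u \o g)))) => B1; last first.
    have B2 : ~~ is_big N (cphi (u q) (u r) (u \o g)).
      case: ok B1; rewrite /cphi; first by case=> ->.
      by case=> t [e1 [e2 [-> -> _]]].
    have B3 : ~~ is_big N (cphi (u p) (u r) (u \o g)).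
      case: ok B1; rewrite /cphi; first by case=> ->.
      by case=> t [e1 [e2 [-> _ ->]]].
    by rewrite -(trunc_inj (esym T1)) // -(trunc_inj (esym T2)) // -(trunc_inj (esym T3)).
  have B2 : is_big N (cphi (u q) (u r) (u \o g)).
    case: ok B1; rewrite /cphi; first by case=> _ ->.
    by case=> t [e1 [e2 [-> -> _]]].
  have B3 : is_big N (cphi (u p) (u r) (u \o g)).
    case: ok B1; rewrite /cphi; first by case=> _ _ ->.
    by case=> t [e1 [e2 [-> _ ->]]].
  have [Ep|pi] := eqVneq p i; first by subst p; exact: tri_new.
  have [Eq|qi] := eqVneq q i.
    subst q; rewrite parC [col tau (u p) (u i) _]tauC; apply: red_ok23.
    by apply: tri_new => //; rewrite cphiC.
  have [Er|ri] := eqVneq r i.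
    subst r; rewrite parR (tauC p i) (tauC q i) (tauC p q); apply: red_okC.
    by apply: tri_new; rewrite cphiC.
  have Eu x : x != i -> u x = Some (s' x) by move=> /negbTE E; rewrite /u E.
  case: (boolP [forall j, g j != i]) => [/forallP gi|].
    have o x y : x != i -> y != i -> old (u x) (u y) (u \o g).
      move=> xi yi; rewrite /old !Eu //=; apply/forallP => j /=; by rewrite Eu.
    rewrite (col_old (o _ _ pi qi)) (col_old (o _ _ qi ri)) (col_old (o _ _ pi ri)).
    have E x : x != i -> so tau (u x) = so M (s' x).
      by move=> xi; rewrite /= phiu sd_old // (sim_so s_sim).
    rewrite !E //; apply: (co_tri M_cons) => //.
    + by rewrite -(trunc_red (cphi_old (o _ _ pi qi))).
    + by rewrite -(trunc_red (cphi_old (o _ _ qi ri))).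
    + by rewrite -(trunc_red (cphi_old (o _ _ pi ri))).
  case/forallPn => j; rewrite negbK => /eqP gj.
  have no x y : ~~ old (u x) (u y) (u \o g).
    rewrite /old !negb_and; apply/orP; right; apply/orP; right; apply/forallPn; exists j.
    by rewrite /= gj /u eqxx.
  rewrite !(col_new (no _ _)) B1 B2 B3.
  rewrite (thirdP r1 r2 r3) (thirdP (r := p) r2) 1?cphiC // (thirdP (r := q) r3) 1?cphiC //;
    last by rewrite cphiC.
  rewrite /mend !Eu //.
  have [_ _ n1 _] := col_red r1; have [_ _ n2 _] := col_red r2; have [_ _ n3 _] := col_red r3.
  have neq x y : x != i -> y != i -> so M (phi (u x)) != so M (phi (u y)) -> s' x != s' y.
    move=> xi yi; rewrite !phiu !sd_old // !(sim_so s_sim).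
    by apply: contraNneq => ->.
  have := neq _ _ pi qi n1; have := neq _ _ qi ri n2; have := neq _ _ pi ri n3.
  rewrite -!Eu // => m3 m2 m1.
  set P := par _ _ _; set P2 := par (_ (_ (u q))) _ _; set P3 := par (_ (_ (u p))) (_ (_ (u r))) _.
  have -> : P2 = P by rewrite /P2 [LHS]parR [LHS]parC [LHS]parR [LHS]parC.
  have -> : P3 = P by rewrite /P3 [LHS]parC [LHS]parR [LHS]parC.
  right; exists N, [&& s' p < s' r, s' q < s' r & P], [&& s' q < s' p, s' r < s' p & P]; split=> //.
  congr (Some (inr (_, _))); exact: max_parity.
- move=> e a b c h /uP [p ->] /uP [q ->] /uP [r ->] /uhP [g ->] ne ga gb.
  have := co_grn M_cons (h := phi \o (u \o g)) Logic.I Logic.I Logic.I (fun=> Logic.I) ne ga gb.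
  by apply: contraNneq => E; apply/eqP; exact: (trunc_white (tau_trunc p q g) E).
- move=> l a b c h _ _ _ _; exact: (co_shd M_cons (h := phi \o h) Logic.I Logic.I Logic.I (fun=> Logic.I)).
Qed.

Let agree_tau : same M tau Some (fun x => x \in F).
Proof.
have phiF x : x \in F -> exists2 p, p != i & x = s' p /\ phi (Some x) = s p.
  move=> xF; have : pointed F (Some x) by apply/pointed_some.
  case/uP => p; rewrite {1}/u; case: eqVneq => // ne [E].
  exists p => //; split=> //; have := phiu p; rewrite sd_old // => <-.
  by rewrite /u (negbTE ne) E.
have phiFh (h : J -> nat) : (forall j, h j \in F) ->
    exists2 g : J -> I, forall j, g j != i & h = s' \o g /\ phi \o (Some \o h) = s \o g.
  move=> hF; have H j : exists p, [/\ p != i, h j = s' p & phi (Some (h j)) = s p].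
    by have [p ? [? ?]] := phiF _ (hF j); exists p.
  have [g Hg] := choice H; exists g; first by move=> j; case: (Hg j).
  by split; apply/funext => j; case: (Hg j).
have lab (h : J -> nat) g : h = s' \o g -> (forall j, g j != i) -> Some \o h = u \o g.
  by move=> -> gi; apply/funext => j; rewrite /u /= (negbTE (gi j)).
split.
- by move=> x /phiF [p pi [-> E]]; rewrite /= E (sim_so s_sim).
- move=> e a b h /phiF [p pi [Ea Pa]] /phiF [q qi [Eb Pb]] /phiFh [g gi [Eh Ph]].
  have -> : grn tau e (Some a) (Some b) (Some \o h) =
            grn M e (phi (Some a)) (phi (Some b)) (phi \o (Some \o h)) by [].
  by rewrite Pa Pb Ph (sim_grn s_sim) -Ea -Eb -Eh.
- move=> a b h /phiF [p pi [Ea Pa]] /phiF [q qi [Eb Pb]] /phiFh [g gi [Eh Ph]].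
  have Eu x : x != i -> u x = Some (s' x) by move=> /negbTE E; rewrite /u E.
  rewrite (lab _ _ Eh gi) Ea Eb -!Eu // col_old //; first by rewrite -Eh.
  by rewrite /old !Eu //; apply/forallP => j; rewrite /= Eu.
- move=> a b h /phiF [p pi [Ea Pa]] /phiF [q qi [Eb Pb]] /phiFh [g gi [Eh Ph]].
  have -> : shd tau (Some a) (Some b) (Some \o h) =
            shd M (phi (Some a)) (phi (Some b)) (phi \o (Some \o h)) by [].
  by rewrite Pa Pb Ph (sim_shd s_sim) -Ea -Eb -Eh.
Qed.

Lemma realise_new : exists d', sim N (upd s i d) (upd s' i d') /\
  (real s' -> real (upd s' i d')).
Proof.
have [d' [d'F S]] := M_ext sizeF tau_cons agree_tau.
exists d'; set s'd := upd s' i d'.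
have vu p : odflt d' (u p) = s'd p by rewrite /s'd /upd /u; case: ifP.
have vuh (g : J -> I) : odflt d' \o (u \o g) = s'd \o g by apply/funext => j; exact: vu.
have d'_new p : p != i -> d' != s' p by move=> pi; apply: contraNneq d'F => ->; exact: memF.
split; first split.
- move=> p q; rewrite /s'd /upd.
  case: (eqVneq p i) => [_|pi]; case: (eqVneq q i) => [_|qi]; rewrite ?eqxx //.
  + by rewrite eq_sym (negbTE (d_new qi)) (negbTE (d'_new _ qi)).
  + by rewrite (negbTE (d_new pi)) eq_sym (negbTE (d'_new _ pi)).
  + exact: (sim_eq s_sim).
- by move=> p; rewrite -[s'd p]vu (sm_so S) //= phiu.
- move=> e p q g; rewrite -(vu p) -(vu q) -vuh (sm_grn S) //; try exact: upt.
    have -> : grn tau e (u p) (u q) (u \o g) = grn M e (phi (u p)) (phi (u q)) (phi \o (u \o g)) by [].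
    by rewrite !phiu phiuh.
  by move=> j; exact: upt.
- move=> p q g; rewrite -(vu p) -(vu q) -vuh (sm_col S) //; try exact: upt.
    by rewrite tau_trunc cphiE.
  by move=> j; exact: upt.
- move=> p q g; rewrite -(vu p) -(vu q) -vuh (sm_shd S) //; try exact: upt.
    have -> : shd tau (u p) (u q) (u \o g) = shd M (phi (u p)) (phi (u q)) (phi \o (u \o g)) by [].
    by rewrite !phiu phiuh.
  by move=> j; exact: upt.
- move=> R p q g; rewrite -(vu p) -(vu q) -vuh (sm_col S) //; try exact: upt.
    case: (boolP (old (u p) (u q) (u \o g))) => [o|no].
      by rewrite col_old //; exact: R.
    rewrite col_new //; case: ifP => B; first exact: fresh_real.
    by move=> E; rewrite E in B.
  by move=> j; exact: upt.
Qed.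

End NewPoint.

(** If [d] repeats an entry of [s] at another position, the same entry of [s'] answers it. The
    clause on [real] lets tuples be approximated by tuples without limit edges. *)
Lemma back_forth N s s' i d : sim N s s' ->
  exists d', sim N (upd s i d) (upd s' i d') /\ (real s' -> real (upd s' i d')).
Proof.
move=> S; case: (pselect (exists2 p, p != i & s p = d)) => [[p pi <-]|new].
  exists (s' p); rewrite !upd_same //; split; first exact: sim_pre.
  exact: real_pre.
apply: realise_new S _ => p pi; apply/eqP => E; apply: new; by exists p.
Qed.
End Similarity.

Import Order.TTheory Order.CTheory.

(** * The algebra of definable relations *)

Section FullSetAlgebra.
Variables (I : eqType) (T : Type) (U : T -> Type).

Lemma full_gcs_axioms : CA_axioms (full_gcs I U).
Proof.
split.
- move=> i; apply/seteqP; split=> // s [t [_ []]].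
- move=> i X; apply/subsetPset => -[j s] Xs; exists s; by split.
- move=> i X Y; apply/seteqP; split=> -[j s].
    case=> t [Et [Xt [v [Ev Yv]]]]; split; first by exists t.
    exists v; split=> // k ki; rewrite Ev //=; exact: Et.
  case=> -[t [Et Xt]] [v [Ev Yv]]; exists t; split=> //; split=> //.
  by exists v; split=> // k ki; rewrite Ev //= Et.
- move=> i i' X.
  have sub (a b : I) : (cyl a (cyl b X) `<=` cyl b (cyl a X))%classic.
    move=> [j s] [t [Et [v [Ev Xv]]]] /=.
    exists (fun k => if k == b then v k else s k); split; first by move=> k /negbTE ->.
    exists v; split=> //= k ka; case: eqVneq => // kb; rewrite Ev //=; exact: Et.
  by apply/seteqP; split; exact: sub.
- by move=> i; apply/seteqP; split.
- move=> i i' l li li'; apply/seteqP; split=> -[j s] /=.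
    move=> E; exists (fun k => if k == l then s i else s k); split; first by move=> k /negbTE ->.
    split; rewrite /= eqxx; first by rewrite eq_sym (negbTE li).
    by rewrite [i' == l]eq_sym (negbTE li').
  by case=> t [Et [/= E1 E2]]; rewrite -(Et i) 1?eq_sym // -(Et i') 1?eq_sym // E1.
- move=> i i' X ii'; apply/seteqP; split=> // -[j s] [[t [Et [/= dt Xt]]] [v [Ev [/= dv Xv]]]].
  apply: Xv; suff <- : t = v by [].
  apply/funext => k; have [->|ki] := eqVneq k i; last by rewrite Et ?Ev.
  by rewrite dt dv Et 1?eq_sym ?Ev // eq_sym.
Qed.

End FullSetAlgebra.

(** * The subalgebra carried by a closed set of elements *)

Section Subalgebra.
Local Open Scope order_scope.
Variables (I : eqType) (A : CA I) (S : A -> Prop).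
Hypothesis S0 : S \bot.
Hypothesis S_compl : forall x, S x -> S (~` x).
Hypothesis S_meet : forall x y, S x -> S y -> S (x `&` y).
Hypothesis S_cyl : forall i x, S x -> S (cyl i x).
Hypothesis S_diag : forall i j, S (diag A i j).

Definition sub_sort : Type := {x : A | `[< S x >]}.

HB.instance Definition _ := Choice.on sub_sort.
HB.instance Definition _ := SubChoice.on sub_sort.

Let S_join x y : S x -> S y -> S (x `|` y).
Proof. by move=> Sx Sy; rewrite -[(_ `|` _)]complK complU; auto. Qed.

Let S1 : S \top.
Proof. by rewrite -compl0; exact: S_compl. Qed.

Definition mk_sub (x : A) (Sx : S x) : sub_sort := exist _ x (asboolT Sx).

Lemma sub_valP (x : sub_sort) : S (val x).
Proof. exact: asboolW (valP x). Qed.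

Let smeet (x y : sub_sort) := mk_sub (S_meet (sub_valP x) (sub_valP y)).
Let sjoin (x y : sub_sort) := mk_sub (S_join (sub_valP x) (sub_valP y)).
Let scompl (x : sub_sort) := mk_sub (S_compl (sub_valP x)).
Let sle (x y : sub_sort) := (val x <= val y).
Let slt (x y : sub_sort) := (val x < val y).

Let sle_def x y : sle x y = (smeet x y == x).
Proof. by rewrite -val_eqE /= -leEmeet. Qed.
Let slt_def x y : slt x y = (y != x) && sle x y.
Proof. by rewrite /slt lt_def -val_eqE. Qed.
Let smeetC : commutative smeet.
Proof. by move=> x y; apply: val_inj; exact: meetC. Qed.
Let sjoinC : commutative sjoin.
Proof. by move=> x y; apply: val_inj; exact: joinC. Qed.
Let smeetA : associative smeet.
Proof. by move=> x y z; apply: val_inj; exact: meetA. Qed.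
Let sjoinA : associative sjoin.
Proof. by move=> x y z; apply: val_inj; exact: joinA. Qed.
Let sjoinKI y x : smeet x (sjoin x y) = x.
Proof. by apply: val_inj; exact: joinKI. Qed.
Let smeetKU y x : sjoin x (smeet x y) = x.
Proof. by apply: val_inj; exact: meetKU. Qed.
Let smeetUl : left_distributive smeet sjoin.
Proof. by move=> x y z; apply: val_inj; exact: meetUl. Qed.
Let smeetxx : idempotent_op smeet.
Proof. by move=> x; apply: val_inj; exact: meetxx. Qed.

HB.instance Definition _ := Order.isMeetJoinDistrLattice.Build
  (cyl_disp A) sub_sort sle_def slt_def smeetC sjoinC smeetA sjoinA sjoinKI
  smeetKU smeetUl smeetxx.

Let sle0x (x : sub_sort) : (mk_sub S0 <= x).
Proof. exact: le0x. Qed.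
Let slex1 (x : sub_sort) : (x <= mk_sub S1).
Proof. exact: lex1. Qed.

HB.instance Definition _ := Order.hasBottom.Build (cyl_disp A) sub_sort sle0x.
HB.instance Definition _ := Order.hasTop.Build (cyl_disp A) sub_sort slex1.

Let sjoinxC (x : sub_sort) : (x `|` scompl x = \top).
Proof. by apply: val_inj; exact: joinxC. Qed.
Let smeetxC (x : sub_sort) : (x `&` scompl x = \bot).
Proof. by apply: val_inj; exact: meetxC. Qed.

HB.instance Definition _ := Order.TBDistrLattice_hasComplement.Build
  (cyl_disp A) sub_sort sjoinxC smeetxC.

Definition sub_cylType : cylType I := {|
  cyl_sort := sub_sort : ctbDistrLatticeType _;
  cyl := fun i (x : sub_sort) => mk_sub (S_cyl i (sub_valP x));
  diag := fun i j => mk_sub (S_diag i j)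
|}.

Lemma sub_axioms : CA_axioms sub_cylType.
Proof.
have B := CA_ax A; split=> [i|i x|i x y|i j x|i|i j l li lj|i j x ij].
- by apply: val_inj; exact: cyl0.
- exact: (@cyl_ge _ _ B i (val x)).
- by apply: val_inj; exact: cylI.
- by apply: val_inj; exact: cylC.
- by apply: val_inj; exact: diagii.
- by apply: val_inj; exact: diag_cyl.
- by apply: val_inj; exact: (cyl_diag B).
Qed.

Definition subalgebra : CA I := MkCA sub_axioms.

Lemma sub_hom : cyl_hom (val : subalgebra -> A).
Proof. by []. Qed.

End Subalgebra.

(** * Relations on the structure that are definable up to truncation *)

Section TupleAlgebra.
Variables (k : nat) (M : str k nat).
Local Notation J := ('I_k).
Local Notation I := ('I_k.+3).
Hypothesis M_cons : cons M (fun=> True).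
Hypothesis M_ext : forall F (tau : str k (option nat)), size F <= k.+2 ->
  cons tau (pointed F) -> same M tau Some (fun x => x \in F) ->
  exists d, d \notin F /\ same tau M (odflt d) (pointed F).

Definition tuples : CA I := MkCA (@full_gcs_axioms I unit (fun=> nat)).
Definition pt (s : I -> nat) : {j : unit & I -> nat} := existT (fun=> I -> nat) tt s.

Definition invariant N (X : tuples) : Prop :=
  forall s s', sim M N s s' -> (X : set _) (pt s) -> (X : set _) (pt s').

(** One bound [N] serves the whole relation. Giving up this uniformity, as in [weakly_inv], leads
    from the algebra to its completion. *)
Definition definable (X : tuples) : Prop := exists N, invariant N X.

Lemma invariant_mono N N' X : N <= N' -> invariant N X -> invariant N' X.
Proof. by move=> le H s s' /(sim_mono le); exact: H. Qed.

Lemma definable0 : definable \bot%O.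
Proof. by exists 0 => s s' _ []. Qed.

Lemma definable_compl X : definable X -> definable (~` X)%O.
Proof.
case=> N H; exists N => s s' S.
by rewrite !complEset => nX X'; apply: nX; exact: H (sim_sym S) X'.
Qed.

Lemma definable_meet X Y : definable X -> definable Y -> definable (X `&` Y)%O.
Proof.
case=> N H [N' H']; exists (maxn N N') => s s' S; rewrite !meetEset => -[Xs Ys]; split.
  exact: (invariant_mono (leq_maxl N N') H) S Xs.
exact: (invariant_mono (leq_maxr N N') H') S Ys.
Qed.

Lemma tuples_cylE i (X : tuples) s : (cyl i X : set _) (pt s) <->
  exists d, (X : set _) (pt (upd s i d)).
Proof.
split=> [[t [Et Xt]]|[d Xd]].
  exists (t i); suff -> : upd s i (t i) = t by [].
  by apply/funext => p; rewrite /upd; case: eqVneq => [->//|/Et ->].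
by exists (upd s i d); split=> // p /negbTE pi; rewrite /upd pi.
Qed.

(** Closure under cylindrification, at the same level [N], is the back-and-forth property. *)
Lemma definable_cyl i X : definable X -> definable (cyl i X).
Proof.
case=> N H; exists N => s s' S /tuples_cylE [d Xd]; apply/tuples_cylE.
have [d' [S' _]] := back_forth M_cons M_ext i d S.
by exists d'; exact: H S' Xd.
Qed.

Lemma definable_diag i j : definable (diag tuples i j).
Proof.
by exists 0 => s s' S /= E; apply/eqP; rewrite -(sim_eq S); apply/eqP.
Qed.

Definition def_alg : CA I := subalgebra definable0 definable_compl definable_meet
  definable_cyl definable_diag.
Local Notation A := def_alg.

Definition holds (x : A) (s : I -> nat) : Prop := (val x : set _) (pt s).

Lemma holdsP (x y : A) : (forall s, holds x s <-> holds y s) -> x = y.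
Proof. by move=> E; apply: val_inj; apply/seteqP; split=> -[[] s]; case: (E s). Qed.

Lemma le_holds (x y : A) : (x <= y)%O <-> (forall s, holds x s -> holds y s).
Proof.
split=> [/subsetPset H s|H]; first exact: H.
by apply/subsetPset => -[[] s]; exact: H.
Qed.

Lemma neq0_holds (x : A) : x <> \bot%O -> exists s, holds x s.
Proof.
move=> nx; apply: contrapT => H; apply: nx; apply: holdsP => s; split=> // Hs.
by case: H; exists s.
Qed.

Lemma holds_cyl i (x : A) s : holds (cyl i x) s <-> exists d, holds x (upd s i d).
Proof. exact: tuples_cylE. Qed.

Definition mk_def (X : tuples) (H : definable X) : A := mk_sub H.

Lemma def_inv (x : A) : exists N, forall s s', sim M N s s' -> holds x s -> holds x s'.
Proof. by have [N H] := sub_valP x; exists N. Qed.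

(** All tuples have entries in one base set, so a nonzero relation becomes the unit once every
    coordinate is cylindrified. A congruence that identifies a nonzero element with 0 therefore
    identifies everything. *)
Lemma def_alg_simple : simple A.
Proof.
split; first by move=> E; have : holds \top%O (fun=> 0) by []; rewrite -E.
move=> R C; case: (pselect (forall x y, R x y -> x = y)) => [|H]; [by left|right].
have [z [nz Rz]] : exists z : A, z <> \bot%O /\ R z \bot%O.
  move/existsNP: H => [x /existsNP [y /not_implyP [Rxy ne]]].
  have aux (a b : A) : R a b -> R (a `&` ~` b)%O \bot%O.
    by move=> Rab; rewrite -(meetxC b); exact: (congrI C) Rab (congr_refl C _).
  case: (pselect ((x `&` ~` y = \bot)%O)) => [E|]; last first.
    by exists (x `&` ~` y)%O; split=> //; exact: aux.
  case: (pselect ((y `&` ~` x = \bot)%O)) => [E'|]; last first.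
    by exists (y `&` ~` x)%O; split=> //; apply: aux; exact: (congr_sym C).
  case: ne; apply/eqP; rewrite eq_le.
  by move/eqP: E; move/eqP: E'; rewrite !disj_leC !complK => -> ->.
pose call := foldr (fun i x => cyl i x) z (enum I).
have call1 : call = \top%O.
  apply: holdsP => t; split=> // _; have [s zs] := neq0_holds nz.
  (* Generalised for the induction: after cylindrifying along [l], only the coordinates outside [l]
     have to agree with [s]. *)
  suff Hl l (u : I -> nat) : (forall p, p \notin l -> u p = s p) ->
      holds (foldr (fun i x => cyl i x) z l) u.
    by apply: Hl => p; rewrite mem_enum.
  elim: l u => [|i l IH] u Eu /=; first by rewrite (_ : u = s) //; apply/funext => p; exact: Eu.
  apply/holds_cyl; exists (s i); apply: IH => p pl; rewrite /upd; case: eqVneq => [->//|ne].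
  by apply: Eu; rewrite inE negb_or ne.
have Rcall : R call \bot%O.
  rewrite /call; elim: (enum I) => //= i l IH.
  by rewrite -(cyl0 (CA_ax A) i); exact: congr_cyl C i _ _ IH.
have R0 x : R x \bot%O.
  by rewrite -[x]meetx1 -(meetx0 x) -call1; exact: (congrI C) (congr_refl C _) Rcall.
by move=> x y; exact: (congr_trans C) (R0 x) ((congr_sym C) _ _ (R0 y)).
Qed.

Lemma def_alg_rca : RCA A.
Proof.
exists unit, (fun=> nat), val; split; first exact: val_inj.
exact: sub_hom.
Qed.

Local Notation args := (I * I * {ffun J -> I})%type.
Definition code_t N : finType :=
  ({ffun I * I -> bool} * {ffun I -> 'I_4 + (bool + J)} * {ffun bool * args -> bool} *
   {ffun args -> option (bool + 'I_N * bool)} * {ffun args -> {set 'I_4}})%type.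

Definition code N (s : I -> nat) : code_t N :=
  ([ffun x : I * I => s x.1 == s x.2], [ffun p => so M (s p)],
   [ffun x : bool * args => grn M x.1 (s x.2.1.1) (s x.2.1.2) (s \o x.2.2)],
   [ffun x : args => trunc N (col M (s x.1.1) (s x.1.2) (s \o x.2))],
   [ffun x : args => shd M (s x.1.1) (s x.1.2) (s \o x.2)]).

Lemma code_sim N s s' : code N s = code N s' -> sim M N s s'.
Proof.
have fg (g : J -> I) : g = finfun g by apply/funext => j; rewrite ffunE.
case=> /ffunP E1 /ffunP E2 /ffunP E3 /ffunP E4 /ffunP E5; split.
- by move=> p q; have := E1 (p, q); rewrite !ffunE.
- by move=> p; have := E2 p; rewrite !ffunE.
- by move=> e p q g; have := E3 (e, (p, q, finfun g)); rewrite !ffunE /= -fg.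
- by move=> p q g; have := E4 (p, q, finfun g); rewrite !ffunE /= -fg.
- by move=> p q g; have := E5 (p, q, finfun g); rewrite !ffunE /= -fg.
Qed.

(** A relation invariant at level [N] is determined by the set of codes of its tuples, a subset of a
    finite type. *)
Lemma def_alg_countable : countable [set: A].
Proof.
have [f Hf] := choice def_inv.
pose enc (x : A) : {N : nat & {set code_t N}} :=
  Tagged (fun N => {set code_t N}) [set c : code_t (f x) | `[< exists s, holds x s /\ code (f x) s = c >]].
have enc_inj : injective enc.
  have memE (x : A) s : holds x s <-> code (f x) s \in tagged (enc x).
    rewrite inE; split=> [xs|/asboolP [t [xt /code_sim]]]; first by apply/asboolP; exists s.
    by move/Hf; exact.
  have tr (e e' : {N : nat & {set code_t N}}) : e = e' -> forall s,
      (code (tag e) s \in tagged e) = (code (tag e') s \in tagged e') by move=> ->.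
  move=> x y E; apply: holdsP => s; have := tr _ _ E s => /= Es.
  split=> /memE H; apply/memE; first by move: H; rewrite [X in is_true X -> _]Es.
  by move: H; rewrite -[X in is_true X -> _]Es.
apply/countable_injP; exists (fun x => pickle (enc x)) => x y _ _ /(pcan_inj pickleK).
exact: enc_inj.
Qed.

(** A constant tuple is real, since an edge between equal tints reads as white. Back-and-forth then
    restores the coordinates of [s] one at a time; [g m] keeps those up to [m]. *)
Lemma real_approx N s : exists s', real M s' /\ sim M N s s'.
Proof.
pose g (m : nat) (p : I) : I := if p <= m then p else ord0.
have H m : exists s', real M s' /\ sim M N (s \o g m) s'.
  elim: m => [|m [s' [R S]]].
    exists (s \o g 0); split=> // p q f.
    have E (x : I) : g 0 x = ord0.
      by rewrite /g leqn0; case: eqP => // E; apply: val_inj.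
    by rewrite /= !E /col eqxx /= !andbF.
  case: (ltnP m.+1 k.+3) => lt; last first.
    suff -> : g m.+1 = g m by exists s'.
    apply/funext => p; rewrite /g.
    have pm : p <= m by have := ltn_ord p; lia.
    by rewrite pm leqW.
  have [d' [S' R']] := back_forth M_cons M_ext (Ordinal lt) (s (Ordinal lt)) S.
  exists (upd s' (Ordinal lt) d'); split; first exact: R'.
  suff -> : s \o g m.+1 = upd (s \o g m) (Ordinal lt) (s (Ordinal lt)) by [].
  apply/funext => p; rewrite /upd /g /= -val_eqE /=; case: (eqVneq (val p) m.+1) => E.
    by rewrite E leqnn; congr s; apply: val_inj.
  by rewrite leq_eqVlt (negbTE E) ltnS.
have [s' [R S]] := H k.+2; exists s'; split=> //.
suff E : s \o g k.+2 = s by rewrite E in S.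
by apply/funext => p; rewrite /g /= -ltnS ltn_ord.
Qed.

Lemma real_bound s : real M s ->
  exists N, forall p q g, ~~ is_big N (col M (s p) (s q) (s \o g)).
Proof.
move=> R; pose b (c : color) : nat := if c is red t _ then t.+1 else 0.
pose N := \max_(x : args) b (col M (s x.1.1) (s x.1.2) (s \o x.2)).
exists N => p q g; have := R p q g.
have : b (col M (s p) (s q) (s \o g)) <= N.
  have -> : g = finfun g by apply/funext => j; rewrite ffunE.
  exact: (@leq_bigmax _ (fun x : args => b (col M (s x.1.1) (s x.1.2) (s \o x.2)))
    (p, q, finfun g)).
by case: (col _ _ _ _) => [[e|[t e]]|] //=; rewrite -ltnNge.
Qed.

Definition simw s s' := forall N, sim M N s s'.

Lemma simw_of s s' N : (forall p q g, ~~ is_big N (col M (s p) (s q) (s \o g))) ->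
  sim M N s s' -> simw s s'.
Proof.
move=> nb S N'; split; try by case: S.
by move=> p q g; rewrite (trunc_inj (sim_col S p q g)).
Qed.

Lemma simw_sym s s' : simw s s' -> simw s' s.
Proof. by move=> S N; exact/sim_sym. Qed.
Lemma simw_trans s1 s2 s3 : simw s1 s2 -> simw s2 s3 -> simw s1 s3.
Proof. by move=> S S' N; apply: sim_trans (S N) (S' N). Qed.

Lemma simw_col s s' : simw s s' -> forall p q g,
  col M (s p) (s q) (s \o g) = col M (s' p) (s' q) (s' \o g).
Proof.
move=> S p q g; move: (col M (s p) _ _) (col M (s' p) _ _) (fun N => sim_col (S N) p q g) => c c' E.
have small (x : color) : x <> None -> exists N, ~~ is_big N x.
  case: x => [[e|[t e]]|] // _; first by exists 0.
  by exists t.+1; rewrite /= ltnn.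
case: (pselect (c = None)) => [cN|/small [N nb]]; last exact: trunc_inj (E N) nb.
case: (pselect (c' = None)) => [->//|/small [N nb]].
exact/esym/(trunc_inj (esym (E N)) nb).
Qed.

(** A real tuple has finitely many labels, none of them the limit. Some level [N] lies above all
    their superscripts and thus determines the full type, which makes the type definable and
    minimal. *)
Lemma cell s : real M s -> exists a : A, atom a /\ forall t, holds a t <-> simw s t.
Proof.
move=> R; have [N nb] := real_bound R.
pose X : tuples := [set x | sim M N s (projT2 x)]%classic.
have dX : definable X by exists N => t t' S St; exact: sim_trans St S.
have aP t : holds (mk_def dX) t <-> simw s t.
  by split=> [/(simw_of nb)|S]; [exact|exact: S].
exists (mk_def dX); split=> //; split.
  by move=> E; have : holds (mk_def dX) s by []; rewrite E.
move=> x /le_holds xa; case: (pselect (x = \bot%O)) => [|nx]; [by left|right].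
have [t xt] := neq0_holds nx; have [N' H] := def_inv x.
apply: holdsP => t'; split=> [/xa//|/aP st'].
have /aP st := xa _ xt; apply: H xt.
exact: sim_trans (sim_sym (st N')) (st' N').
Qed.

Lemma def_alg_cells x : x <> \bot%O ->
  exists s (a : A), [/\ real M s, atom a, (a <= x)%O & forall t, holds a t <-> simw s t].
Proof.
move=> nx; have [s xs] := neq0_holds nx; have [N H] := def_inv x.
have [s' [R S]] := real_approx N s; have [a [aa aP]] := cell R.
exists s', a; split=> //; apply/le_holds => t /aP st.
by apply: H xs; apply: sim_trans S (st N).
Qed.

Lemma def_alg_atomic : atomic A.
Proof. by move=> x /def_alg_cells [s [a [_ ? ? _]]]; exists a. Qed.

Lemma atom_cell (a : A) : atom a -> exists s, real M s /\ forall t, holds a t <-> simw s t.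
Proof.
case=> na amin; have [s [b [R [nb _] ba bP]]] := def_alg_cells na.
by case: (amin b ba) => // E; exists s; rewrite -E.
Qed.

End TupleAlgebra.

(** * Neat embedding of representable algebras *)

(** A relation becomes a cylinder of infinite sequences, by restriction to the first n + 1
    coordinates. Injectivity needs every finite tuple to be continued to an infinite one, which
    [inord] does in positive dimension by repeating an entry. *)
Lemma RCA_NEP n (A : cylType (dim_idx (Fin n.+1))) : RCA A -> NEP A.
Proof.
case=> T [U [g [g_inj gH]]].
pose B : CA (dim_idx Omega) := MkCA (@full_gcs_axioms nat T U).
exists isT, B.
pose restr (s : {j : T & nat -> U j}) : {j : T & 'I_n.+1 -> U j} :=
  existT _ (projT1 s) (projT2 s \o val).
pose X (x : A) : B := (restr @^-1` (g x))%classic.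
have neatX x : neat (@dim_incl (Fin n.+1) Omega isT) (X x).
  apply/neatP => j Nj; apply/seteqP; split; last first.
    by move=> s Xs; exists (projT2 s); case: s Xs.
  move=> [l s] [t [Et Xt]]; rewrite /X /restr /= in Xt *.
  suff -> : s \o val = t \o val :> ('I_n.+1 -> U l) by [].
  by apply/funext => p /=; rewrite Et //; apply/eqP => E; apply: Nj; exists p.
exists (fun x => mkNeat (neatX x)); split.
  move=> x y [/seteqP [E1 E2]]; apply: g_inj.
  have K l (s : 'I_n.+1 -> U l) : restr (existT _ l (fun m => s (inord m))) = existT _ l s.
    by congr existT; apply/funext => p /=; rewrite inord_val.
  apply/seteqP; split=> -[l s].
    by move=> H; have := E1 (existT _ l (fun m => s (inord m))); rewrite /X /preimage /= K; apply.
  by move=> H; have := E2 (existT _ l (fun m => s (inord m))); rewrite /X /preimage /= K; apply.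
split.
- by move=> x y; apply: val_inj; rewrite /= /X (homI gH).
- by move=> x y; apply: val_inj; rewrite /= /X (homU gH).
- by move=> x; apply: val_inj; rewrite /= /X (homC gH).
- by apply: val_inj; rewrite /= /X (hom0 gH).
- by apply: val_inj; rewrite /= /X (hom1 gH).
- move=> i x; apply: val_inj; rewrite /= /X (hom_cyl gH).
  apply/seteqP; split=> -[l s] [t [Et Xt]].
    exists (fun m => if m == val i then t i else s m); split; first by move=> m /negbTE ->.
    rewrite /preimage /restr /=; rewrite /restr /= in Xt.
    suff -> : (fun m => if m == val i then t i else s m) \o val = t by [].
    apply/funext => p /=; rewrite val_eqE; case: eqVneq => [->//|ne].
    by rewrite Et.
  exists (t \o val); split=> //= p pi; rewrite Et //.
- move=> i j; apply: val_inj; rewrite /= /X (hom_diag gH).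
  by apply/seteqP; split=> -[l s].
Qed.

(** * Substitutions in cylindric algebras *)

Section Substitution.
Local Open Scope order_scope.
Variables (K : eqType) (B : CA K).
Implicit Types (i j l m : K) (x y z : B).
Let ax := CA_ax B.

(** For [i != j] this is the usual substitution operator of cylindric algebras, replacing coordinate
    [i] by [j]; for [i = j] it is [cyl i]. *)
Definition subst i j x : B := cyl i (diag B i j `&` x).

Lemma cyl_idemp i x : cyl i (cyl i x) = cyl i x.
Proof. exact: cyl_idem. Qed.

Lemma cyl_mono i x y : x <= y -> cyl i x <= cyl i y.
Proof.
move=> xy; have /meet_l <- : x <= cyl i y by apply: le_trans xy _; exact: cyl_ge ax _ _.
by rewrite (cylI ax) leIr.
Qed.

Lemma cyl_fixC i x : cyl i x = x -> cyl i (~` x) = ~` x.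
Proof.
move=> E; apply/eqP; rewrite eq_le (cyl_ge ax) andbT -disj_leC; apply/eqP.
by rewrite -{2}E -(cylI ax) E meetC meetxC (cyl0 ax).
Qed.

Lemma cyl_fixU i x y : cyl i x = x -> cyl i y = y -> cyl i (x `|` y) = x `|` y.
Proof.
move=> Ex Ey; rewrite -[x `|` y]complK; apply: cyl_fixC; rewrite complU.
by rewrite -{1}(cyl_fixC Ey) (cylI ax) !cyl_fixC.
Qed.

Lemma cylU i x y : cyl i (x `|` y) = cyl i x `|` cyl i y.
Proof.
apply/eqP; rewrite eq_le; apply/andP; split; last first.
  by rewrite leUx; apply/andP; split; apply: cyl_mono; rewrite ?leUl ?leUr.
rewrite -(cyl_fixU (cyl_idemp i x) (cyl_idemp i y)); apply: cyl_mono.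
by rewrite leUx; apply/andP; split; apply: le_trans (cyl_ge ax i _) _; rewrite ?leUl ?leUr.
Qed.

Lemma cyl_diagl i j : i != j -> cyl i (diag B i j) = \top.
Proof.
move=> ij; apply/eqP; rewrite -le1x -(diagii ax j) (@diag_cyl _ _ ax j j i) //.
by apply: cyl_mono; exact: leIr.
Qed.

Lemma cyl_diagr i j : i != j -> cyl j (diag B i j) = \top.
Proof.
move=> ij; apply/eqP; rewrite -le1x -(diagii ax i) (@diag_cyl _ _ ax i i j) 1?eq_sym //.
by apply: cyl_mono; exact: leIl.
Qed.

Lemma cyl_diag_fix i j l : l != i -> l != j -> cyl l (diag B i j) = diag B i j.
Proof. by move=> li lj; rewrite (diag_cyl ax li lj) cyl_idemp. Qed.

Lemma subst_mono i j x y : x <= y -> subst i j x <= subst i j y.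
Proof. by move=> xy; apply: cyl_mono; exact: leI2. Qed.

Lemma subst0 i j : subst i j \bot = \bot.
Proof. by rewrite /subst meetx0 (cyl0 ax). Qed.

Lemma substU i j x y : subst i j (x `|` y) = subst i j x `|` subst i j y.
Proof. by rewrite /subst meetUr cylU. Qed.

(** Split [y] along [x]: the last cylindric axiom makes the substitutes of [x] and of its complement
    disjoint, which removes the part of [y] outside [x]. *)
Lemma substI i j x y : i != j -> subst i j (x `&` y) = subst i j x `&` subst i j y.
Proof.
move=> ij; apply/eqP; rewrite eq_le lexI !subst_mono ?leIl ?leIr //=.
have {1}-> : y = (x `&` y) `|` (~` x `&` y) by rewrite -meetUl joinxC meet1x.
rewrite substU meetUr leUx leIr /=.
apply: le_trans (_ : subst i j x `&` subst i j (~` x) <= _).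
  by rewrite leI2 // subst_mono // leIl.
by rewrite (cyl_diag ax x ij) le0x.
Qed.

Lemma subst_fix i j x : i != j -> cyl i x = x -> subst i j x = x.
Proof. by move=> ij E; rewrite /subst -{1}E (cylI ax) cyl_diagl // meet1x. Qed.

Lemma cyl_subst i j x : cyl i (subst i j x) = subst i j x.
Proof. exact: cyl_idemp. Qed.

Lemma cyl_subst_target i j x : i != j -> cyl j x = x -> cyl j (subst i j x) = cyl i x.
Proof.
by move=> ij E; rewrite /subst (cylC ax) -{1}E (cylI ax) cyl_diagr // meet1x E.
Qed.

Lemma cyl_subst_other i j l x : l != i -> l != j ->
  cyl l (subst i j x) = subst i j (cyl l x).
Proof.
move=> li lj; rewrite /subst (cylC ax) meetC -{1}(cyl_diag_fix li lj) (cylI ax).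
by rewrite cyl_diag_fix // meetC.
Qed.

Lemma subst_comp i j l x : i != j -> j != l -> i != l -> cyl j x = x ->
  subst j l (subst i j x) = subst i l x.
Proof.
move=> ij jl il E; rewrite /subst -(cyl_diag_fix ij il) meetC -(cylI ax).
rewrite cyl_diag_fix // (cylC ax) meetC meetA -{1}E (cylI ax).
by rewrite [diag B j l `&` _]meetC -(diag_cyl ax) ?E // eq_sym.
Qed.

Lemma subst_comm i j l m x : i != l -> i != m -> l != j ->
  subst i j (subst l m x) = subst l m (subst i j x).
Proof.
move=> il im lj; rewrite /subst.
have li : l != i by rewrite eq_sym.
rewrite -(cyl_diag_fix li lj) meetC -(cylI ax) (cyl_diag_fix li lj) (cylC ax).
rewrite -[in RHS](cyl_diag_fix il im) [in RHS]meetC -(cylI ax) (cyl_diag_fix il im).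
congr (cyl _ (cyl _ _)); rewrite meetC meetA [RHS]meetC meetA.
by rewrite [diag B i j `&` _]meetC.
Qed.

End Substitution.

(** * The complex algebra *)

Section ComplexAlgebra.
Variables (k : nat) (M : str k nat).
Local Notation J := ('I_k).
Local Notation I := ('I_k.+3).
Local Notation sort_t := ('I_4 + (bool + 'I_k))%type.
Local Notation apex i := (inl i : sort_t).
Local Notation base e := (inr (inl e) : sort_t).
Local Notation side j := (inr (inr j) : sort_t).
Hypothesis M_cons : cons M (fun=> True).
Hypothesis M_ext : forall F (tau : str k (option nat)), size F <= k.+2 ->
  cons tau (pointed F) -> same M tau Some (fun x => x \in F) ->
  exists d, d \notin F /\ same tau M (odflt d) (pointed F).
Hypothesis M_base : [/\ so M 0 = base false, so M 1 = base true,
  forall j : J, so M j.+2 = side j & shd M 0 1 (fun j => j.+2) = finset.setT].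

Local Notation A := (def_alg M_cons M_ext).
Local Notation C := (Cm (At A)).

Implicit Types (Phi Psi : (I -> nat) -> Prop).

(** No common truncation level is asked for, so [Phi] need not be definable; on real tuples it is a
    union of atoms, hence an element of the complex algebra. *)
Definition weakly_inv Phi := forall s s', simw M s s' -> Phi s -> Phi s'.

Definition ats Phi : C := [set a : At A | exists s, holds (sval a) s /\ Phi s]%classic.

Lemma at_real (a : At A) s : holds (sval a) s -> real M s.
Proof.
have [t [R aP]] := atom_cell (svalP a); move/aP => S p q g.
by rewrite -(simw_col S); exact: R.
Qed.

Lemma at_sim (a : At A) s t : holds (sval a) s -> holds (sval a) t -> simw M s t.
Proof.
have [u [R aP]] := atom_cell (svalP a); move=> /aP us /aP ut.
by apply: simw_trans ut; exact: simw_sym.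
Qed.

Lemma at_point (a : At A) : exists s, holds (sval a) s.
Proof. by have [nz _] := svalP a; exact: neq0_holds. Qed.

Lemma real_at s : real M s -> exists a : At A, forall t, holds (sval a) t <-> simw M s t.
Proof. by move=> /(cell M_cons M_ext) [a [aa aP]]; exists (exist _ a aa). Qed.

Lemma at_relE i (a b : At A) s d : holds (sval a) s -> holds (sval b) (upd s i d) ->
  at_rel i a b.
Proof.
move=> As Bs; have [_ amin] := svalP a.
have := amin (sval a `&` cyl i (sval b))%O (leIl _ _).
case=> [E|E]; last by rewrite /= -E leIr.
have : holds (sval a `&` cyl i (sval b))%O s by split=> //; apply/holds_cyl; exists d.
by rewrite E.
Qed.

Lemma at_rel_holds i (a b : At A) s : at_rel i a b -> holds (sval a) s ->
  exists d, holds (sval b) (upd s i d).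
Proof. by move=> /le_holds H /H /holds_cyl. Qed.

Lemma atsP Phi (a : At A) s : weakly_inv Phi -> holds (sval a) s ->
  (ats Phi : set _) a <-> Phi s.
Proof.
move=> W As; split=> [[t [At' Pt]]|Ps]; last by exists s.
exact: W (at_sim At' As) Pt.
Qed.

Lemma ats_fix i Phi : weakly_inv Phi -> (forall s d, Phi (upd s i d) -> Phi s) ->
  cyl i (ats Phi) = ats Phi.
Proof.
move=> W H; apply/seteqP; split=> a.
  case=> b Pb ab; have [t at_] := at_point a; have [d bd] := at_rel_holds ab at_.
  by exists t; split=> //; apply: H; apply/(atsP W bd).
case=> s [As Ps]; exists a; first by exists s.
by apply: (at_relE (d := s i) As); rewrite (_ : upd s i (s i) = s) //;
  apply/funext => p; rewrite /upd; case: eqVneq => [->|].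
Qed.

(** An atom must be found that holds the updated tuple. It exists because repeating a coordinate
    keeps a tuple real. *)
Lemma ats_subst i j Phi : i != j -> weakly_inv Phi ->
  cyl i (diag C i j `&` ats Phi)%O = ats (fun s => Phi (upd s i (s j))).
Proof.
move=> ij W; apply/seteqP; split=> a.
  case=> b; rewrite meetEset => -[/le_holds dij Pb] ab.
  have [t at_] := at_point a; have [d bd] := at_rel_holds ab at_.
  exists t; split=> //; have /(_ _ bd) := dij.
  rewrite /holds /= /upd eqxx [j == i]eq_sym (negbTE ij) => <-.
  exact/(atsP W bd).
case=> s [As Ps]; have R := at_real As.
have R' : real M (upd s i (s j)) by rewrite upd_same 1?eq_sym //; exact: real_pre.
have [b bP] := real_at R'.
have bs : holds (sval b) (upd s i (s j)) by apply/bP.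
exists b; last exact: at_relE As bs.
rewrite meetEset; split; last by exists (upd s i (s j)).
apply/le_holds => t /bP S; rewrite /holds /=; apply/eqP; rewrite -(sim_eq (S 0)).
by rewrite /upd eqxx [j == i]eq_sym (negbTE ij).
Qed.

Local Notation o0 := (@Ordinal k.+3 0 isT).
Local Notation o1 := (@Ordinal k.+3 1 isT).
Local Notation o2 := (@Ordinal k.+3 2 isT).
Definition h0 (j : J) : I := @rshift 3 k j.

Lemma index_cases (p : I) : [\/ p = o0, p = o1, p = o2 | exists j, p = h0 j].
Proof.
case: p => [[|[|[|m]]] lt].
- by apply: Or41; exact: val_inj. - by apply: Or42; exact: val_inj.
- by apply: Or43; exact: val_inj.
by apply: Or44; exists (Ordinal (lt : m < k)); exact: val_inj.
Qed.

(* Positions 0, 1, 2 of an n-tuple hold an apex and two base points, or up to three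
   apexes; the side tuple sits at the positions from 3 on. *)
Definition at_tint (t : 'I_4) a s := so M (s a) = apex t /\ prp M (s \o h0).
Definition at_grn e t a b s := at_tint t a s /\ grn M e (s a) (s b) (s \o h0).
(** Parity is kept while the superscript is forgotten, which no truncation does: [trunc N] loses
    both on large reds. *)
Definition class_of (c : color) : option (bool + bool) :=
  match c with None => None | white e => Some (inl e) | red _ e => Some (inr e) end.
Definition at_edge c t t' a b s := [/\ at_tint t a s, at_tint t' b s &
  class_of (col M (s a) (s b) (s \o h0)) = Some c].
Definition at_base s := [/\ so M (s o1) = base false, so M (s o2) = base true,
  prp M (s \o h0) & shd M (s o1) (s o2) (s \o h0) = finset.setT].
Definition at_cone t s := [/\ so M (s o0) = apex t, at_base s &
  over M (s o0) (s o1) (s o2) (s \o h0)].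

Let prp_sim s s' : simw M s s' -> prp M (s \o h0) = prp M (s' \o h0).
Proof. by move=> S; apply: eq_forallb => j /=; rewrite (sim_so (S 0)). Qed.

Lemma inv_tint t a : weakly_inv (at_tint t a).
Proof. by move=> s s' S; rewrite /at_tint (prp_sim S) (sim_so (S 0)). Qed.

Lemma inv_grn e t a b : weakly_inv (at_grn e t a b).
Proof. by move=> s s' S [/(inv_tint S) D]; rewrite (sim_grn (S 0)). Qed.

Lemma inv_edge c t t' a b : weakly_inv (at_edge c t t' a b).
Proof. by move=> s s' S [/(inv_tint S) D /(inv_tint S) D']; rewrite (simw_col S). Qed.

Lemma inv_base : weakly_inv at_base.
Proof.
by move=> s s' S; rewrite /at_base (prp_sim S) !(sim_so (S 0)) (sim_shd (S 0)).
Qed.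

Lemma inv_cone t : weakly_inv (at_cone t).
Proof.
move=> s s' S [E /(inv_base S) Bs o]; split=> //; first by rewrite -(sim_so (S 0)).
by rewrite /over -!(sim_grn (S 0)).
Qed.

Lemma base_real : exists s, real M s /\ at_base s.
Proof.
have [s0 s1 sj sS] := M_base.
(* The points 0, 1 and 2, ..., k + 1 of [M] go to positions 1, 2 and 3, ..., k + 2; position 0
   repeats the first base point. *)
pose s (p : I) : nat := p.-1.
have E : s \o h0 = (fun j : J => j.+2) by apply/funext.
have sA p : is_apex (so M (s p)) = false.
  by case: (index_cases p) => [->|->|->|[j ->]]; rewrite /s /= ?s0 ?s1 ?sj.
exists s; split; first by move=> p q g; rewrite /col sA.
by split; rewrite ?E //; apply/forallP => j; rewrite sj.
Qed.

(** Base and side points leave no apex among the positions other than 0. So the new apex has no edge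
    to be labelled, and the one condition left, that its tint be allowed, holds over a base of this
    kind. *)
Lemma cone_over_base t s : real M s -> at_base s ->
  exists d, real M (upd s o0 d) /\ at_cone t (upd s o0 d).
Proof.
move=> R [sb sc P sS].
pose F := [seq s p | p <- enum (predC1 o0)].
have sizeF : size F <= k.+2 by rewrite size_map -cardE cardC1 card_ord.
have memF p : p != o0 -> s p \in F by move=> ne; apply: map_f; rewrite mem_enum.
have casesF x : x \in F -> [\/ x = s o1, x = s o2 | exists j, x = s (h0 j)].
  case/mapP => p; rewrite mem_enum inE /= => ne ->.
  case: (index_cases p) ne => [->//|->|->|[j ->]] _; [exact: Or31|exact: Or32|].
  by apply: Or33; exists j.
have sh j : so M (s (h0 j)) = side j by exact/eqP/(forallP P).
have nA x : x \in F -> is_apex (so M x) = false.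
  by case/casesF => [->|->|[j ->]]; rewrite ?sb ?sc ?sh.
pose tau : str k (option nat) := Str
  (fun x => if x is Some y then so M y else apex t)
  (fun a b h => if a is Some x then gr0 M x (odflt 0 b) (odflt 0 \o h) else true)
  (fun a b h => if a is Some x then co0 M x (odflt 0 b) (odflt 0 \o h) else None)
  (fun a b h => if a is Some x then sh0 M x (odflt 0 b) (odflt 0 \o h) else finset.set0).
have tA x : pointed F x -> is_apex (so tau x) -> x = None.
  by case: x => // x /pointed_some xF /=; rewrite nA.
have colW a b h : pointed F a -> pointed F b -> col tau a b h = white false.
  move=> aF bF; rewrite /col; case: ifP => // /and4P [/(tA _ aF) -> /(tA _ bF) ->].
  by rewrite eqxx.
have ag : same M tau Some (fun x => x \in F) by [].
have tc : cons tau (pointed F).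
  split.
  - by move=> a b h aF bF _; rewrite !colW.
  - by move=> a b c h aF bF cF _; rewrite colW.
  - move=> e a b d h aF bF _ _ ne ga gb.
    have [/(tA _ aF) Ea _ _] := grnP ga; have [/(tA _ bF) Eb _ _] := grnP gb.
    by rewrite Ea Eb eqxx in ne.
  move=> i a b c h aF bF cF hF sa /andP [g0 g1].
  have [_ tb Pt] := grnP g0; have [_ tc _] := grnP g1; clear g0 g1.
  have Eb : b = Some (s o1).
    case: b bF tb => [x /pointed_some /casesF|] // [->|->|[j ->]] //=; first by rewrite sc.
    by rewrite sh.
  have Ec : c = Some (s o2).
    case: c cF tc => [x /pointed_some /casesF|] // [->|->|[j ->]] //=; first by rewrite sb.
    by rewrite sh.
  have Eh : h = Some \o (s \o h0).
    apply/funext => j; have := eqP (forallP Pt j); have := hF j.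
    case: (h j) => [x /pointed_some /casesF|] // [->|->|[j' ->]] /=; rewrite ?sb ?sc ?sh //.
    by case=> ->.
  have -> : shd tau b c h = shd M (s o1) (s o2) (s \o h0) by rewrite Eb Ec Eh.
  by rewrite sS finset.in_setT.
have [d [dF S]] := M_ext sizeF tc ag.
pose u p := if p == o0 then None else Some (s p).
have up p : pointed F (u p).
  by rewrite /u; case: eqVneq => [_|/memF /pointed_some //]; exact: mem_head.
have vu p : odflt d (u p) = upd s o0 d p by rewrite /upd /u; case: ifP.
have vuh (g : J -> I) : odflt d \o (u \o g) = upd s o0 d \o g by apply/funext => j; exact: vu.
have Eh : upd s o0 d \o h0 = s \o h0 by [].
have soN : so M d = apex t by rewrite -[d]/(odflt d None) (sm_so S) //; exact: mem_head.
exists d; split.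
  move=> p q g; rewrite -(vu p) -(vu q) -vuh (sm_col S) ?colW //; try exact: up.
  by move=> j; exact: up.
have gN e x : so M (s x) = base e -> x != o0 -> grn M e d (s x) (s \o h0).
  move=> sx xo.
  have := sm_grn S e (a := None) (b := Some (s x)) (h := Some \o (s \o h0)).
  rewrite /= => ->.
  - by rewrite /grn /= sx eqxx /= andbT; exact: P.
  - exact: mem_head.
  - by apply/pointed_some; exact: memF.
  - by move=> j; apply/pointed_some; exact: memF.
split=> //.
by rewrite /over; apply/andP; split; [exact: (gN false o1)|exact: (gN true o2)].
Qed.

Lemma ats_cone t : cyl o0 (ats (at_cone t)) = ats at_base.
Proof.
apply/seteqP; split=> a.
  case=> b Pb ab; have [s As] := at_point a; have [d bd] := at_rel_holds ab As.
  exists s; split=> //.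
  by have /(atsP (inv_cone (t := t)) bd) [_ [? ? ? ?] _] := Pb.
case=> s [As Bs]; have [d [R Cd]] := cone_over_base t (at_real As) Bs.
have [b bP] := real_at R.
have bd : holds (sval b) (upd s o0 d) by apply/bP.
by exists b; [exists (upd s o0 d)|exact: at_relE As bd].
Qed.

(** * Apexes at spare coordinates of a dilation *)

Section Dilation.
Local Open Scope order_scope.
Variables (K : eqType) (f : I -> K) (B : CA K) (h : C -> B).
Hypothesis f_inj : injective f.
Hypothesis h_inj : injective h.
Hypothesis hI : forall x y, h (x `&` y) = h x `&` h y.
Hypothesis hU : forall x y, h (x `|` y) = h x `|` h y.
Hypothesis h_bot : h \bot = \bot.
Hypothesis h_cyl : forall i x, h (cyl i x) = cyl (f i) (h x).
Hypothesis h_diag : forall i j, h (diag C i j) = diag B (f i) (f j).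
Hypothesis h_out : forall u x, ~ range f u -> cyl u (h x) = h x.

Definition im Phi : B := h (ats Phi).

Lemma im_mono Phi Psi : (forall s, real M s -> Phi s -> Psi s) -> im Phi <= im Psi.
Proof.
move=> H; have /meet_l E : (ats Phi <= ats Psi :> C)%O.
  apply/subsetPset => a [s [As Ps]]; exists s; split=> //; apply: H Ps; exact: at_real As.
by rewrite leEmeet -hI E.
Qed.

Lemma im_bot Phi : (forall s, real M s -> ~ Phi s) -> im Phi = \bot.
Proof.
move=> H; rewrite -h_bot; congr h; apply/seteqP; split=> // a [s [As Ps]].
by case: (H s (at_real As)).
Qed.

Lemma im_meet Phi Psi : weakly_inv Psi ->
  im Phi `&` im Psi <= im (fun s => Phi s /\ Psi s).
Proof.
move=> W; rewrite -hI; set X := (_ `&` _); have /meet_l E : (X <= ats (fun s => Phi s /\ Psi s) :> C)%O.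
  apply/subsetPset => a; rewrite /X meetEset => -[[s [As Ps]] Qa].
  by exists s; split=> //; split=> //; apply/(atsP W As).
by rewrite leEmeet -hI E.
Qed.

Lemma im_join Phi Psi : im (fun s => Phi s \/ Psi s) <= im Phi `|` im Psi.
Proof.
rewrite -hU /im; set X := ats (fun s => _); set Y := (_ `|` _); have /meet_l E : (X <= Y :> C)%O.
  by apply/subsetPset => a [s [As [Ps|Ps]]]; rewrite /Y joinEset; [left|right]; exists s.
by rewrite leEmeet -hI E.
Qed.

Lemma im_cyl i Phi : weakly_inv Phi -> (forall s d, Phi (upd s i d) -> Phi s) ->
  cyl (f i) (im Phi) = im Phi.
Proof. by move=> W H; rewrite /im -h_cyl ats_fix. Qed.

Lemma im_subst i j Phi : i != j -> weakly_inv Phi ->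
  subst (f i) (f j) (im Phi) = im (fun s => Phi (upd s i (s j))).
Proof. by move=> ij W; rewrite /subst /im -h_diag -hI -h_cyl ats_subst. Qed.

Local Notation F0 := (f o0).
Local Notation F1 := (f o1).
Local Notation F2 := (f o2).

Let F01 : F0 != F1. Proof. by rewrite inj_eq. Qed.
Let F02 : F0 != F2. Proof. by rewrite inj_eq. Qed.
Let F12 : F1 != F2. Proof. by rewrite inj_eq. Qed.
Let F20 : F2 != F0. Proof. by rewrite inj_eq. Qed.
Let F21 : F2 != F1. Proof. by rewrite inj_eq. Qed.
Let F10 : F1 != F0. Proof. by rewrite inj_eq. Qed.

Definition spare u := ~ range f u.

Lemma spare_neq i u : spare u -> f i != u.
Proof. by move=> N; apply/eqP => E; apply: N; exists i. Qed.

(* The distinction is needed because [subst F0 F0] is [cyl F0], not the identity. *)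
Definition move u (x : B) : B := if u == F0 then x else subst F0 u x.

Lemma moveF u x : spare u -> move u x = subst F0 u x.
Proof. by move=> /(spare_neq o0); rewrite /move eq_sym => /negbTE ->. Qed.

Lemma move_mono u x y : x <= y -> move u x <= move u y.
Proof. by rewrite /move; case: ifP => // _; exact: subst_mono. Qed.

Lemma move_bot u : move u \bot = \bot.
Proof. by rewrite /move; case: ifP => // _; exact: subst0. Qed.

Lemma moveU u x y : move u (x `|` y) = move u x `|` move u y.
Proof. by rewrite /move; case: ifP => // _; exact: substU. Qed.

Lemma moveI u x y : move u (x `&` y) = move u x `&` move u y.
Proof. by rewrite /move; case: eqVneq => // ne; apply: substI; rewrite eq_sym. Qed.

Lemma move_fix u x : cyl F0 x = x -> move u x = x.
Proof. by rewrite /move; case: eqVneq => // ne; apply: subst_fix; rewrite eq_sym. Qed.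

(** The relation between positions 0 and 1, moved to coordinates [u] and [v] of the dilation; [u]
    may still be the coordinate of position 0. *)
Definition edge c t t' u v := move u (subst F1 v (im (at_edge c t t' o0 o1))).
Definition cone t u := move u (im (at_cone t)).

Let cyl2_edge c t t' : cyl F2 (im (at_edge c t t' o0 o1)) = im (at_edge c t t' o0 o1).
Proof. by apply: im_cyl => //; exact: inv_edge. Qed.

Let edge02 c t t' : im (at_edge c t t' o0 o2) = subst F1 F2 (im (at_edge c t t' o0 o1)).
Proof. by rewrite im_subst //; exact: inv_edge. Qed.

Let edge12 c t t' : im (at_edge c t t' o1 o2) = subst F0 F1 (im (at_edge c t t' o0 o2)).
Proof. by rewrite im_subst //; exact: inv_edge. Qed.

Let tr3_bot (Phi1 Phi2 Phi3 : (I -> nat) -> Prop) : weakly_inv Phi2 -> weakly_inv Phi3 ->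
  (forall s, real M s -> Phi1 s -> Phi2 s -> Phi3 s -> False) ->
  im Phi1 `&` im Phi2 `&` im Phi3 = \bot.
Proof.
move=> W2 W3 H; apply/eqP; rewrite -lex0.
apply: le_trans (leI2 (im_meet _ W2) (lexx _)) _.
apply: le_trans (im_meet _ W3) _.
by rewrite im_bot // => s R [[? ?] ?]; exact: H R _ _ _.
Qed.

Lemma edge_triangle c1 c2 c3 t t' t'' u v w : spare v -> spare w ->
  (forall s, real M s -> at_edge c1 t t' o0 o1 s -> at_edge c2 t' t'' o1 o2 s ->
    at_edge c3 t t'' o0 o2 s -> False) ->
  edge c1 t t' u v `&` edge c2 t' t'' v w `&` edge c3 t t'' u w = \bot.
Proof.
move=> sv sw H.
pose tr x := move u (subst F1 v (subst F2 w x)).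
have trI x y : tr (x `&` y) = tr x `&` tr y by rewrite /tr !substI ?moveI ?(spare_neq _ sv) ?(spare_neq _ sw).
have E1 : tr (im (at_edge c1 t t' o0 o1)) = edge c1 t t' u v.
  by rewrite /tr (subst_fix (i := F2)) ?(spare_neq _ sv) ?(spare_neq _ sw).
have E3 : tr (im (at_edge c3 t t'' o0 o2)) = edge c3 t t'' u w.
  rewrite /tr edge02 subst_comp ?(spare_neq _ sv) ?(spare_neq _ sw) //.
  by rewrite (subst_fix (j := v)) ?(spare_neq _ sv) ?(spare_neq _ sw) ?cyl_subst.
have E2 : tr (im (at_edge c2 t' t'' o1 o2)) = edge c2 t' t'' v w.
  rewrite /tr edge12 edge02 (subst_comm (i := F2) (l := F0)) ?(spare_neq _ sv) ?(spare_neq _ sw) //.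
  rewrite (subst_comp (i := F1)) ?(spare_neq _ sv) ?(spare_neq _ sw) //.
  rewrite subst_comp ?(spare_neq _ sv) ?(spare_neq _ sw) ?cyl_subst // move_fix ?cyl_subst //.
  by rewrite /edge moveF.
rewrite -E1 -E2 -E3 -!trI.
rewrite tr3_bot; [|exact: inv_edge|exact: inv_edge|exact: H].
by rewrite /tr !subst0 move_bot.
Qed.

Let grn_edge e t t' a b c s : real M s -> t != t' ->
  at_grn e t a b s -> at_grn e t' c b s -> at_edge (inl e) t t' a c s -> False.
Proof.
move=> _ ne [[sa _] ga] [[sc _] gc] [_ _].
have : so M (s a) != so M (s c) by rewrite sa sc; apply: contraNneq ne => -[->].
move=> sne; have := co_grn M_cons (h := s \o h0) Logic.I Logic.I Logic.I (fun=> Logic.I) sne ga gc.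
by case: (col _ _ _ _) => [[e'|[x e']]|] //= + [E]; rewrite E eqxx.
Qed.

Let cone_grn e t s : at_cone t s -> at_grn e t o0 (if e then o2 else o1) s.
Proof.
by case=> st [_ _ P _] /andP [g0 g1]; case: e; split=> //; split.
Qed.

(** Refuting [white e] takes only the base point of kind [e], at position [a]. The position [b] of
    the other base point is thereby free to hold the second apex, and n positions suffice. *)
Lemma cone_white e t t' u v : spare v -> t != t' ->
  cone t u `&` cone t' v `&` edge (inl e) t t' u v = \bot.
Proof.
move=> sv ne.
pose a := if e then o2 else o1; pose b := if e then o1 else o2.
have ab : b != a by rewrite /a /b; case: (e).
have b0 : o0 != b by rewrite /b; case: (e).
have a0 : o0 != a by rewrite /a; case: (e).
pose tr x := move u (subst (f b) v x).
have trI x y : tr (x `&` y) = tr x `&` tr y by rewrite /tr !substI ?moveI ?(spare_neq _ sv).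
have E3 : tr (im (at_edge (inl e) t t' o0 b)) = edge (inl e) t t' u v.
  rewrite /tr /b; case: (e) => //; by rewrite edge02 subst_comp ?(spare_neq _ sv).
have cylb t1 : cyl (f b) (im (at_grn e t1 o0 a)) = im (at_grn e t1 o0 a).
  apply: im_cyl; first exact: inv_grn.
  by rewrite /a /b => s d; case: (e).
have E1 : cone t u <= tr (im (at_grn e t o0 a)).
  rewrite /tr subst_fix ?(spare_neq _ sv) //; apply: move_mono; apply: im_mono => s _.
  exact: cone_grn.
have E2 : cone t' v <= tr (im (at_grn e t' b a)).
  have -> : im (at_grn e t' b a) = subst F0 (f b) (im (at_grn e t' o0 a)).
    rewrite im_subst //; last exact: inv_grn.
    by rewrite /a /b; case: (e).
  rewrite /tr subst_comp ?(spare_neq _ sv) ?inj_eq //.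
  rewrite move_fix ?cyl_subst // /cone moveF //; apply: subst_mono; apply: im_mono => s _.
  exact: cone_grn.
apply/eqP; rewrite -lex0.
apply: le_trans (leI2 (leI2 E1 E2) (lexx _)) _; rewrite -E3 -!trI.
rewrite tr3_bot ?/tr ?subst0 ?move_bot //; [exact: inv_grn|exact: inv_edge|].
by move=> s R; exact: grn_edge.
Qed.

(** Atoms hold real tuples only, so in the complex algebra the four classes cover all edges between
    the two tints; the two white ones are excluded by [cone_white]. *)
Lemma cone_edge t t' u v : spare v -> t != t' ->
  cone t u `&` cone t' v <= edge (inr false) t t' u v `|` edge (inr true) t t' u v.
Proof.
move=> sv ne.
pose tr x := move u (subst F1 v x).
have trI x y : tr (x `&` y) = tr x `&` tr y by rewrite /tr !substI ?moveI ?(spare_neq _ sv).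
have trU x y : tr (x `|` y) = tr x `|` tr y by rewrite /tr !substU ?moveU.
have tr_mono x y : x <= y -> tr x <= tr y by move=> xy; apply/move_mono/subst_mono.
have cyl1 t1 : cyl F1 (im (at_tint t1 o0)) = im (at_tint t1 o0).
  by apply: im_cyl => //; exact: inv_tint.
have sub_tint t1 s : at_cone t1 s -> at_tint t1 o0 s by case=> st [_ _ P _] _.
have E1 : cone t u <= tr (im (at_tint t o0)).
  rewrite /tr subst_fix ?(spare_neq _ sv) //; apply: move_mono; apply: im_mono => s _.
  exact: sub_tint.
have E2 : cone t' v <= tr (im (at_tint t' o1)).
  have -> : im (at_tint t' o1) = subst F0 F1 (im (at_tint t' o0)).
    by rewrite im_subst //; exact: inv_tint.
  rewrite /tr subst_comp ?(spare_neq _ sv) //.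
  rewrite move_fix ?cyl_subst // /cone moveF //; apply: subst_mono; apply: im_mono => s _.
  exact: sub_tint.
pose E c := im (at_edge c t t' o0 o1).
have cover : im (at_tint t o0) `&` im (at_tint t' o1) <=
    (E (inl false) `|` E (inl true)) `|` (E (inr false) `|` E (inr true)).
  apply: le_trans (im_meet _ (@inv_tint t' o1)) _.
  pose any s := (at_edge (inl false) t t' o0 o1 s \/ at_edge (inl true) t t' o0 o1 s) \/
                (at_edge (inr false) t t' o0 o1 s \/ at_edge (inr true) t t' o0 o1 s).
  apply: (@le_trans _ _ (im any)).
    apply: im_mono => s R [D D']; rewrite /any /at_edge.
    have := R o0 o1 h0; case: (col M _ _ _) => [[[]|[x []]]|] // _.
    - by left; right. - by left; left. - by right; right. - by right; left.
  by apply: le_trans (im_join _ _) _; apply: leU2; exact: im_join.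
have := le_trans (leI2 E1 E2) _; rewrite -trI => /(_ _ (tr_mono _ _ cover)).
rewrite !trU; set W := tr _ `|` tr _; set R := (X in _ <= _ `|` X) => le.
have : cone t u `&` cone t' v `&` W = \bot.
  by rewrite /W meetUr !cone_white // joinxx.
move=> dis; move/meet_l: le => <-; rewrite meetUr dis join0x.
exact: leIr.
Qed.

Lemma cyl_cone t u : spare u -> cyl u (cone t u) = im at_base.
Proof.
move=> su; rewrite /cone moveF // cyl_subst_target ?(spare_neq _ su) //; last exact: h_out.
by rewrite /im -h_cyl ats_cone.
Qed.

Lemma cyl_cone_other t u v : spare v -> v != u -> cyl v (cone t u) = cone t u.
Proof.
move=> sv vu; rewrite /cone /move; case: eqVneq => [_|ne]; first exact: h_out.
by rewrite cyl_subst_other ?h_out // eq_sym spare_neq.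
Qed.

Lemma cone_base t : cone t F0 <= im at_base.
Proof. by rewrite /cone /move eqxx; apply: im_mono => s _ []. Qed.

Let im_base_neq0 : im at_base <> \bot.
Proof.
move=> E; have [s [R Bs]] := base_real; have [a aP] := real_at R.
have : (ats at_base : set _) a by exists s; split=> //; apply/aP.
have -> : ats at_base = \bot :> C by apply: h_inj; rewrite h_bot.
by [].
Qed.

(** As [x] is fixed by [cyl u], applying [cyl u] to the meet yields [x] met with the whole base,
    that is, [x]. Hence cones can be piled up at further coordinates without reaching 0. *)
Let cut u x t : spare u -> cyl u x = x -> x <= im at_base ->
  x `&` cone t u = \bot -> x = \bot.
Proof.
move=> su Ex xb E; have := congr1 (cyl u) E.
rewrite (cyl0 (CA_ax B)) -{1}Ex meetC (cylI (CA_ax B)) cyl_cone // Ex meetC.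
by move/meet_l: xb => ->.
Qed.

(** Shrinking a nonzero element, once for each of the six edges, takes the place of choosing an
    ultrafilter of [B]. *)
Let pick_edge z t t' u v : spare v -> t != t' -> z <> \bot ->
  z <= cone t u -> z <= cone t' v ->
  exists e, exists2 z', z' <> \bot & z' <= z /\ z' <= edge (inr e) t t' u v.
Proof.
move=> sv ne nz zu zv.
have ze : z <= edge (inr false) t t' u v `|` edge (inr true) t t' u v.
  by apply: le_trans (cone_edge u sv ne); rewrite lexI zu zv.
case: (pselect (z `&` edge (inr false) t t' u v = \bot)) => [E|n0]; last first.
  by exists false, (z `&` edge (inr false) t t' u v) => //; rewrite leIl leIr.
case: (pselect (z `&` edge (inr true) t t' u v = \bot)) => [E'|n1]; last first.
  by exists true, (z `&` edge (inr true) t t' u v) => //; rewrite leIl leIr.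
by case: nz; move/meet_l: ze => <-; rewrite meetUr E E' joinxx.
Qed.

Let parity e1 e2 e3 t t' t'' u v w z : spare v -> spare w -> z <> \bot ->
  z <= edge (inr e1) t t' u v -> z <= edge (inr e2) t' t'' v w ->
  z <= edge (inr e3) t t'' u w ->
  e3 = e1 (+) e2 (+) par (apex t : sort_t) (apex t') (apex t'').
Proof.
move=> sv sw nz z1 z2 z3; apply: contrapT => ne; apply: nz; apply/eqP.
rewrite -lex0 -(@edge_triangle (inr e1) (inr e2) (inr e3) t t' t'' u v w sv sw).
  by rewrite !lexI z1 z2 z3.
move=> s R [[s0 _] [s1 _] c1] [_ [s2 _] c2] [_ _ c3]; apply: ne.
have isr c e : class_of c = Some (inr e) -> is_red c by case: c => [[]|].
have := co_tri M_cons (h := s \o h0) Logic.I Logic.I Logic.I (fun=> Logic.I)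
  (isr _ _ c1) (isr _ _ c2) (isr _ _ c3).
rewrite s0 s1 s2; case=> [[E]|[x [e [e' [E1 E2 E3]]]]]; first by rewrite E in c1.
by move: c1 c2 c3; rewrite E1 E2 E3 => -[->] [->] [->].
Qed.

(* Apexes of the four tints over one base are put at the indices 0, p, q, r. *)
Lemma no_dilation p q r : spare p -> spare q -> spare r ->
  p != q -> p != r -> q != r -> False.
Proof.
move=> sp sq sr pq pr qr.
pose t0 := @Ordinal 4 0 isT; pose t1 := @Ordinal 4 1 isT.
pose t2 := @Ordinal 4 2 isT; pose t3 := @Ordinal 4 3 isT.
pose x0 := cone t0 F0; pose x1 := x0 `&` cone t1 p; pose x2 := x1 `&` cone t2 q.
pose x3 := x2 `&` cone t3 r.
have x0b : x0 <= im at_base := cone_base t0.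
have x1b : x1 <= im at_base by apply: le_trans x0b; exact: leIl.
have x2b : x2 <= im at_base by apply: le_trans x1b; exact: leIl.
have cylx u : spare u -> cyl u x0 = x0.
  by move=> su; apply: cyl_cone_other => //; rewrite eq_sym; exact: spare_neq.
have cyl_meet (u : K) (x y : B) : cyl u x = x -> cyl u y = y -> cyl u (x `&` y) = x `&` y.
  by move=> Ex Ey; have := cylI (CA_ax B) u x y; rewrite Ey Ex.
have nx0 : x0 <> \bot.
  move=> E; apply: im_base_neq0; have : cyl F0 x0 = im at_base.
    by rewrite /x0 /cone /move eqxx /im -h_cyl ats_cone.
  by rewrite E (cyl0 (CA_ax B)).
have nx1 : x1 <> \bot.
  by move=> E; apply: nx0; apply: (cut sp _ x0b E); exact: cylx sp.
have nx2 : x2 <> \bot.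
  move=> E; apply: nx1; apply: (cut sq _ x1b E); apply: (cyl_meet _ _ _); first exact: cylx sq.
  by apply: cyl_cone_other => //; rewrite eq_sym.
have nx3 : x3 <> \bot.
  move=> E; apply: nx2; apply: (cut sr _ x2b E); apply: (cyl_meet _ _ _).
    apply: (cyl_meet _ _ _); first exact: cylx sr.
    by apply: cyl_cone_other => //; rewrite eq_sym.
  by apply: cyl_cone_other => //; rewrite eq_sym.
have c3 : x3 <= cone t3 r by exact: leIr.
have c2 : x3 <= cone t2 q by apply: le_trans (leIl _ _) _; exact: leIr.
have c1 : x3 <= cone t1 p by apply: le_trans (leIl _ _) _; apply: le_trans (leIl _ _) _; exact: leIr.
have c0 : x3 <= cone t0 F0 by apply: le_trans (leIl _ _) _; apply: le_trans (leIl _ _) _; exact: leIl.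
have step z t t' u v : spare v -> t != t' -> z <> \bot -> z <= x3 ->
    x3 <= cone t u -> x3 <= cone t' v ->
    exists e, exists z', [/\ z' <> \bot, z' <= z, z' <= x3 & z' <= edge (inr e) t t' u v].
  move=> sv ne nz zx cu cv.
  have [e [z' nz' [zz ze]]] := pick_edge sv ne nz (le_trans zx cu) (le_trans zx cv).
  by exists e, z'; split=> //; exact: le_trans zx.
have [e01 [z1 [n1 _ l1 d1]]] := step x3 t0 t1 F0 p sp isT nx3 (lexx _) c0 c1.
have [e02 [z2 [n2 m2 l2 d2]]] := step z1 t0 t2 F0 q sq isT n1 l1 c0 c2.
have [e03 [z3 [n3 m3 l3 d3]]] := step z2 t0 t3 F0 r sr isT n2 l2 c0 c3.
have [e12 [z4 [n4 m4 l4 d4]]] := step z3 t1 t2 p q sq isT n3 l3 c1 c2.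
have [e13 [z5 [n5 m5 l5 d5]]] := step z4 t1 t3 p r sr isT n4 l4 c1 c3.
have [e23 [z6 [n6 m6 l6 d6]]] := step z5 t2 t3 q r sr isT n5 l5 c2 c3.
have g4 := le_trans m6 m5; have g3 := le_trans g4 m4.
have g2 := le_trans g3 m3; have g1 := le_trans g2 m2.
(* The triangles with tints 012, 013, 023 and 123; [par] is true for the last one only. *)
have := parity sp sq n6 (le_trans g1 d1) (le_trans g4 d4) (le_trans g2 d2).
have := parity sp sr n6 (le_trans g1 d1) (le_trans m6 d5) (le_trans g3 d3).
have := parity sq sr n6 (le_trans g2 d2) d6 (le_trans g3 d3).
have := parity sq sr n6 (le_trans g4 d4) d6 (le_trans m6 d5).
rewrite /par /=.
by case: e01 e02 e03 e12 e13 e23 {d1 d2 d3 d4 d5 d6} => [] [] [] [] [] [].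
Qed.

End Dilation.
End ComplexAlgebra.

(** * Dilations of dimension at least n + 3 *)

Lemma spare_indices (m : dim) (k : nat) (ab : dim_le (Fin k) m) : dim_le (Fin (k + 3)) m ->
  exists p q r : dim_idx m, [/\ ~ range (dim_incl ab) p, ~ range (dim_incl ab) q,
    ~ range (dim_incl ab) r & [/\ p != q, p != r & q != r]].
Proof.
case: m ab => [m|] ab /= le.
  have lt i : i < 3 -> k + i < m by lia.
  exists (Ordinal (lt 0 isT)), (Ordinal (lt 1 isT)), (Ordinal (lt 2 isT)).
  by split; [move=> [i _ /(congr1 val)] /= E; have := ltn_ord i; lia..|
    rewrite -!val_eqE /=; split; lia].
exists k, k.+1, k.+2.
by split; [move=> [i _ /= E]; have := ltn_ord i; lia..|split; lia].
Qed.

Lemma def_alg_not_complex_SNEP k (M : str k nat) M_cons M_ext (m : dim) :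
  [/\ so M 0 = inr (inl false), so M 1 = inr (inl true),
    forall j : 'I_k, so M j.+2 = inr (inr j) &
    shd M 0 1 (fun j => j.+2) = finset.setT] ->
  dim_le (Fin (k.+3 + 3)) m -> ~ @complex_SNEP (Fin k.+3) m (@def_alg k M M_cons M_ext).
Proof.
move=> M_base le [ab [B [g [g_inj gH]]]].
have [p [q [r [sp sq sr [pq pr qr]]]]] := spare_indices ab le.
apply: (@no_dilation k M M_cons M_ext M_base _ (@dim_incl (Fin k.+3) m ab) B
  (fun x => val (g x)) _ _ _ _ _ _ _ _ p q r) => //.
- exact: (@dim_incl_inj (Fin k.+3) m ab).
- by move=> x y /val_inj /g_inj.
- by move=> x y; rewrite (homI gH).
- by move=> x y; rewrite (homU gH).
- by rewrite (hom0 gH).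
- by move=> i x; rewrite (hom_cyl gH).
- by move=> i j; rewrite (hom_diag gH).
- by move=> u x Nu; have /neatP H := @neat_valP _ _ _ _ (g x); exact: H.
Qed.

Theorem theorem3p2 (n : nat) (hn : (2 < n)%N) :
  exists A : CA (dim_idx (Fin n)),
    [/\ atomic A, simple A, countable [set: A], RCA A /\ NEP A
      & forall m : dim, dim_le (Fin (n + 3)) m -> ~ complex_SNEP m A].
Proof.
case: n hn => [|[|[|k]]] // _.
have [M [M_cons M_ext M_base]] := homogeneous_str k.
have rca := def_alg_rca M_cons M_ext.
exists (def_alg M_cons M_ext); split.
- exact: def_alg_atomic.
- exact: def_alg_simple.
- exact: def_alg_countable.
- by split; [exact: rca|exact: (@RCA_NEP k.+2 (def_alg M_cons M_ext))].
- by move=> m; exact: def_alg_not_complex_SNEP.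
Qed.
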